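(* Let $N$ be a finite set of agents, $O$ a finite set of objects with copy numbers $(q_x)_{x\in O}$ satisfying $\sum_{x\in O}q_x\ge |N|$, and let $\mathcal{D}$ be either the unrestricted domain $\mathcal{R}$ of strict preference profiles or (when $O$ contains a null object $\emptyset$ with $q_\emptyset=|N|$) the restricted domain $\underline{\mathcal{R}}$ of profiles in which every agent ranks $\emptyset$ last. Let $f:\mathcal{D}\to\Delta(\mathcal{M})$ be a random assignment rule satisfying ex-post efficiency and equal-treatment-of-equals. Then the following statements are equivalent: (1) $f$ satisfies probabilistic monotonicity; (2) $f$ satisfies both strategy-proofness and weak object-wise non-bossiness; (3) $f$ satisfies pairwise responsiveness; (4) $f$ is the Random Priority rule on $\mathcal{D}$, i.e. $f(R)=RP(R)$ for all $R\in\mathcal{D}$.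
   Context: Setting. $N$ is a finite set of $n=|N|$ agents, $O$ a finite set of objects; object $x\in O$ has $q_x\geq 1$ copies, and $\sum_{x\in O}q_x\ge|N|$. Each agent $i$ has a strict preference $R_i$ over $O$ (a linear order: complete, transitive, antisymmetric) with asymmetric part $P_i$. $\mathcal{R}^i$ is the set of all linear orders on $O$ and $\mathcal{R}=\times_{i\in N}\mathcal{R}^i$. If $O$ contains a distinguished null object $\emptyset$ with $q_\emptyset=|N|$, then $\underline{\mathcal{R}}\subseteq\mathcal{R}$ is the set of profiles in which every agent ranks $\emptyset$ last. All definitions below are relative to the chosen domain $\mathcal{D}\in\{\mathcal{R},\underline{\mathcal{R}}\}$: all profiles mentioned (including those after a change of one agent's preference) are required to lie in $\mathcal{D}$. $U(x,R_i)=\{y\in O: y\,P_i\,x\}$ is the strict upper contour set. $N_{R_i}$ is the set of preferences $R_i'$ that differ from $R_i$ by swapping exactly two objects that are adjacent in $R_i$, all other comparisons being unchanged. Assignments. An assignment is a map $\mu:N\to O$ with $|\{i:\mu_i=x\}|\le q_x$ for all $x$; $\mathcal{M}$ is the set of assignments. $\mu$ is efficient under $R$ if there is no $\mu'\in\mathcal{M}$ with $\mu'_iR_i\mu_i$ for all $i$ and $\mu'_jP_j\mu_j$ for some $j$. A random assignment is $p\in\Delta(\mathcal{M})$, a probability distribution on $\mathcal{M}$, with $p_\mu$ the probability of $\mu$; $p^{ia}=\sum_{\mu:\mu_i=a}p_\mu$ and $p^i=(p^{ia})_{a\in O}$. A random assignment rule is a map $f:\mathcal{D}\to\Delta(\mathcal{M})$;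 $f_\mu(R)$, $f^{ia}(R)$, $f^i(R)$ are the corresponding quantities for $f(R)$. Axioms. - Ex-post efficiency: for all $R\in\mathcal{D}$, $f_\mu(R)>0$ implies $\mu$ is efficient under $R$. - Equal-treatment-of-equals: for all $R\in\mathcal{D}$, all $i,j$ with $R_i=R_j$, and all $\mu,\mu'\in\mathcal{M}$ with $\mu_i=\mu'_j$, $\mu_j=\mu'_i$, $\mu_k=\mu'_k$ for $k\ne i,j$, one has $f_\mu(R)=f_{\mu'}(R)$. - Probabilistic monotonicity: $R'$ is a $\mu$-monotonic transformation of $R$ if $U(\mu_i,R'_i)\subseteq U(\mu_i,R_i)$ for all $i\in N$; the axiom requires $f_\mu(R')\ge f_\mu(R)$ for all $R,R'\in\mathcal{D}$ and $\mu\in\mathcal{M}$ such that $R'$ is a $\mu$-monotonic transformation of $R$. - Strategy-proofness: for all $R\in\mathcal{D}$, all $i\in N$, all $R_i'$ (with $(R_i',R_{-i})\in\mathcal{D}$), and all $x\in O$, $\sum_{y\in U(x,R_i)}f^{iy}(R)\ge\sum_{y\in U(x,R_i)}f^{iy}(R'_i,R_{-i})$. - Weak object-wise non-bossiness: for all $i\in N$, $x,y,z\in O$, $R\in\mathcal{D}$, and $R'_i\in N_{R_i}$ with $xP_iy$ and $yP'_ix$ (and $(R_i',R_{-i})\in\mathcal{D}$): if $f^{iz}(R)=f^{iz}(R'_i,R_{-i})$ then $f_\mu(R)=f_\mu(R'_i,R_{-i})$ for all $\mu\in\mathcal{M}$ with $\mu_i=z$. - Pairwise responsiveness: for all $i\in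 N$, $x,y\in O$, $R\in\mathcal{D}$, $R'_i\in N_{R_i}$ with $xP_iy$ and $yP'_ix$ (and $(R_i',R_{-i})\in\mathcal{D}$), and all $\mu\in\mathcal{M}$: $\mu_i\notin\{x,y\}$ implies $f_\mu(R)=f_\mu(R'_i,R_{-i})$. Random Priority. For a strict linear order $\rhd$ on $N$, $f^\rhd(R)$ is the (deterministic) assignment in which agents, one after another in order of $\rhd$, receive their most-preferred object among those with at least one copy still available. $RP(R)=\frac{1}{n!}\sum_{\rhd}f^\rhd(R)$, the sum being over all strict linear orders on $N$ (each $f^\rhd(R)$ viewed as a point mass in $\Delta(\mathcal{M})$). *)

(* Defs.v *)
From HB Require Import structures.
From mathcomp Require Import all_boot all_order all_algebra.
Set Implicit Arguments.
Unset Strict Implicit.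
Unset Printing Implicit Defensive.
Import Order.TTheory GRing.Theory Num.Theory.
Local Open Scope ring_scope.

(* Orders are stored as sets of pairs, so that equality of preferences is     *)
(* extensional and the type of all linear orders is finite.                   *)
Definition is_linear_order (T : finType) (r : {set T * T}) : bool :=
  [&& [forall x, forall y, ((x, y) \in r) || ((y, x) \in r)],
      [forall x, forall y, ((x, y) \in r) && ((y, x) \in r) ==> (x == y)]
    & [forall x, forall y, forall z,
         ((x, y) \in r) && ((y, z) \in r) ==> ((x, z) \in r)]].

Record linorder (T : finType) := LinOrder {
  order_set : {set T * T};
  _ : is_linear_order order_set }.

HB.instance Definition _ (T : finType) := [isSub for @order_set T].
HB.instance Definition _ (T : finType) := [Finite of linorder T by <:].

Definition weak (T : finType) (r : linorder T) : rel T :=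
  fun x y => (x, y) \in order_set r.

Definition strict (T : finType) (r : linorder T) : rel T :=
  fun x y => weak r x y && ~~ weak r y x.

Definition upper (O : finType) (x : O) (r : linorder O) : {set O} :=
  [set y | strict r y x].

(* x is immediately above y in r. *)
Definition adjacent (O : finType) (r : linorder O) (x y : O) : Prop :=
  strict r x y /\ forall z, ~ (strict r x z /\ strict r z y).

Definition neighbour (O : finType) (r r' : linorder O) : Prop :=
  exists x y : O,
    [/\ adjacent r x y,
        strict r' y x
      & forall a b : O, [set a; b] != [set x; y] ->
          weak r' a b = weak r a b].

Notation profile N O := {ffun N -> linorder O}.

Definition replace (N O : finType) (R : profile N O) (i : N) (r : linorder O) :
    profile N O :=
  [ffun j => if j == i then r else R j].

Variant pref_domain (O : finType) :=
  | Unrestricted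
  | NullLast of O.
Arguments Unrestricted {O}.

Definition in_domain (N O : finType) (D : pref_domain O) (R : profile N O) :
    bool :=
  match D with
  | Unrestricted => true
  | NullLast null => [forall i, forall x, weak (R i) x null]
  end.

Definition null_capacity (N O : finType) (q : O -> nat) (D : pref_domain O) :
    Prop :=
  match D with
  | Unrestricted => True
  | NullLast null => q null = #|N|
  end.

Record dprofile (N O : finType) (D : pref_domain O) := DProfile {
  profile_of :> profile N O;
  _ : in_domain D profile_of }.

HB.instance Definition _ (N O : finType) (D : pref_domain O) :=
  [isSub for @profile_of N O D].
HB.instance Definition _ (N O : finType) (D : pref_domain O) :=
  [Finite of dprofile N D by <:].

Record assignment (N O : finType) (q : O -> nat) := Assignment {
  assign :> {ffun N -> O};
  _ : [forall x, #|[set i | assign i == x]| <= q x]%N }.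

HB.instance Definition _ (N O : finType) (q : O -> nat) :=
  [isSub for @assign N O q].
HB.instance Definition _ (N O : finType) (q : O -> nat) :=
  [Finite of assignment N q by <:].

Definition efficient (N O : finType) (q : O -> nat) (R : profile N O)
    (mu : assignment N q) : Prop :=
  ~ exists mu' : assignment N q,
      (forall i, weak (R i) (mu' i) (mu i)) /\
      (exists j, strict (R j) (mu' j) (mu j)).

Record random_assignment (K : realFieldType) (N O : finType) (q : O -> nat) :=
  RandomAssignment {
    prob :> {ffun assignment N q -> K};
    _ : forall mu, 0 <= prob mu;
    _ : \sum_mu prob mu = 1 }.

Definition marginal (K : realFieldType) (N O : finType) (q : O -> nat)
    (p : random_assignment K N q) (i : N) (a : O) : K :=
  \sum_(mu : assignment N q | mu i == a) p mu.

Definition rule (K : realFieldType) (N O : finType) (q : O -> nat)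
    (D : pref_domain O) :=
  dprofile N D -> random_assignment K N q.

Section RuleProperties.
Variables (K : realFieldType) (N O : finType) (q : O -> nat).
Variables (D : pref_domain O) (f : rule K N q D).

Definition ex_post_efficient : Prop :=
  forall (R : dprofile N D) (mu : assignment N q),
    0 < f R mu -> efficient R mu.

Definition equal_treatment : Prop :=
  forall (R : dprofile N D) (i j : N), R i = R j ->
  forall mu mu' : assignment N q,
    mu i = mu' j -> mu j = mu' i ->
    (forall k, k != i -> k != j -> mu k = mu' k) ->
    f R mu = f R mu'.

Definition monotonic_transformation (mu : assignment N q)
    (R R' : profile N O) : Prop :=
  forall i, upper (mu i) (R' i) \subset upper (mu i) (R i).

Definition prob_monotonic : Prop :=
  forall (R R' : dprofile N D) (mu : assignment N q),
    monotonic_transformation mu R R' -> f R mu <= f R' mu.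

Definition strategy_proof : Prop :=
  forall (R : dprofile N D) (i : N) (r : linorder O)
         (hD : in_domain D (replace R i r)) (x : O),
    \sum_(y in upper x (R i)) marginal (f (DProfile hD)) i y
      <= \sum_(y in upper x (R i)) marginal (f R) i y.

Definition weakly_objectwise_nonbossy : Prop :=
  forall (i : N) (x y z : O) (R : dprofile N D) (r : linorder O)
         (hD : in_domain D (replace R i r)),
    neighbour (R i) r -> strict (R i) x y -> strict r y x ->
    marginal (f R) i z = marginal (f (DProfile hD)) i z ->
    forall mu : assignment N q, mu i = z -> f R mu = f (DProfile hD) mu.

Definition pairwise_responsive : Prop :=
  forall (i : N) (x y : O) (R : dprofile N D) (r : linorder O)
         (hD : in_domain D (replace R i r)),
    neighbour (R i) r -> strict (R i) x y -> strict r y x ->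
    forall mu : assignment N q, mu i \notin [set x; y] ->
      f R mu = f (DProfile hD) mu.

End RuleProperties.

(* Partial assignments, where None marks an agent who has not chosen yet.     *)
Definition available (N O : finType) (q : O -> nat)
    (nu : {ffun N -> option O}) (x : O) : bool :=
  (#|[set j | nu j == Some x]| < q x)%N.

Definition choose_best (N O : finType) (q : O -> nat) (R : profile N O)
    (nu : {ffun N -> option O}) (i : N) : {ffun N -> option O} :=
  [ffun j => if j == i
     then [pick x | available q nu x &&
                    [forall y, available q nu y ==> weak (R i) x y]]
     else nu j].

(* A strict priority order is represented by its reflexive closure t; the     *)
(* agents move in the order of the sorted enumeration, highest priority first.*)
(* When \sum_x q x >= #|N|, some object is always available, so every agent   *)
(* ends up with Some object.                                                  *)
Definition serial_dictatorship (N O : finType) (q : O -> nat)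
    (R : profile N O) (t : linorder N) : {ffun N -> option O} :=
  foldl (choose_best q R) [ffun=> None] (sort (weak t) (enum N)).

Definition random_priority (K : realFieldType) (N O : finType) (q : O -> nat)
    (R : profile N O) (mu : assignment N q) : K :=
  (#|N|`!%:R)^-1 *
  \sum_(t : linorder N)
     (serial_dictatorship q R t == [ffun i => Some (mu i)])%:R.

(* Main.v *)
Require Import Defs.
From mathcomp Require Import all_boot all_order all_algebra.
From mathcomp Require Import all_fingroup zify.
Set Implicit Arguments.
Unset Strict Implicit.
Unset Printing Implicit Defensive.
Import Order.TTheory GRing.Theory Num.Theory.
Local Open Scope ring_scope.

(* Pairwise responsiveness implies Random Priority: let d = f - RP. By pairwise
   responsiveness d R mu depends only on the upper contour sets of the objects
   mu i in R i; d inherits equal treatment and efficiency, and its values sum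
   to 0. Such a signed d vanishes on the profiles respecting a given weak order
   on O, by induction on refinements of that order. Pick an object a that is not
   alone in its class; d vanishes at profiles where every agent puts a at the
   bottom of its class. Let H be the set of agents who do not. Inductively, d
   vanishes once some agent of H moves a one step down, so d only charges
   assignments giving each h in H either a or the object lam h just below a.
   Efficiency then determines how many agents of H get a, and requires that
   lam h be below a for each t in H who gets a. As lam h may be any object of the
   class below a, these constraints and equal treatment make the total of d over
   the completions of each assignment of H vanish, and d is an instance of the
   same problem for the agents outside H, who all put a at the bottom. *)

(** * Linear orders *)

Section LinearOrders.
Variable T : finType.
Implicit Types (r : linorder T) (x y z : T).

Lemma linorderP r : [/\ total (weak r), antisymmetric (weak r) & transitive (weak r)].
Proof.
case: r => A HA; have /and3P[/forallP tot /forallP anti /forallP tr] := HA.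
rewrite /weak /=; split.
- by move=> x y; move/forallP: (tot x) => /(_ y).
- by move=> x y; move/forallP: (anti x) => /(_ y) /implyP h /h /eqP.
- move=> y x z xy yz; move/forallP: (tr x) => /(_ y) /forallP /(_ z) /implyP.
  by apply; apply/andP.
Qed.

Lemma weak_total r : total (weak r). Proof. by case: (linorderP r). Qed.
Lemma weak_anti r : antisymmetric (weak r). Proof. by case: (linorderP r). Qed.
Lemma weak_trans r : transitive (weak r). Proof. by case: (linorderP r). Qed.
Lemma weak_refl r : reflexive (weak r).
Proof. by move=> x; have := weak_total r x x; rewrite orbb. Qed.

Lemma strictNweak r x y : strict r x y = ~~ weak r y x.
Proof.
rewrite /strict; case: (boolP (weak r y x)) => h; first by rewrite andbF.
by rewrite andbT; have := weak_total r x y; rewrite (negbTE h) orbF.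
Qed.

(** Comparing ranks replaces comparing objects, so that order reasoning becomes arithmetic for
    [lia]. *)
Definition rank r x : nat := #|upper x r|.

Lemma strict_rank r x y : strict r x y = (rank r x < rank r y)%N.
Proof.
have mono u v : strict r u v -> (rank r u < rank r v)%N.
  move=> uv; apply: proper_card; apply/properP; split.
    apply/subsetP=> z; rewrite !inE => zu; rewrite strictNweak.
    apply/negP => vz; move: uv; rewrite strictNweak => /negP; apply.
    by apply: weak_trans vz _; case/andP: zu.
  by exists u; rewrite !inE // strictNweak weak_refl.
apply/idP/idP; first exact: mono.
apply: contraTT; rewrite strictNweak negbK => yx; rewrite -leqNgt.
case: (boolP (weak r x y)) => xy.
  by rewrite (weak_anti (introT andP (conj xy yx))).
by apply/ltnW/mono; rewrite strictNweak.
Qed.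

Lemma weak_rank r x y : weak r x y = (rank r x <= rank r y)%N.
Proof. by rewrite leqNgt -strict_rank strictNweak negbK. Qed.

Lemma rank_inj r : injective (rank r).
Proof. by move=> x y e; apply: (@weak_anti r); rewrite !weak_rank e leqnn. Qed.

Lemma rank_lt_card r x : (rank r x < #|T|)%N.
Proof.
rewrite -cardsT; apply: proper_card; apply/properP; split; first exact: subsetT.
by exists x; rewrite // inE strict_rank ltnn.
Qed.

Lemma linorder_ext r r' : (forall x y, weak r x y = weak r' x y) -> r = r'.
Proof. by move=> e; apply: val_inj; apply/setP=> -[x y]; apply: e. Qed.

Fact order_by_subproof (g : T -> nat) (g_inj : injective g) :
  is_linear_order [set p | (g p.1 <= g p.2)%N].
Proof.
apply/and3P; split.
- by apply/forallP=> x; apply/forallP=> y; rewrite !inE leq_total.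
- apply/forallP=> x; apply/forallP=> y; rewrite !inE /= -eqn_leq.
  by apply/implyP=> /eqP/g_inj->.
- apply/forallP=> x; apply/forallP=> y; apply/forallP=> z; rewrite !inE /=.
  by apply/implyP=> /andP[]; apply: leq_trans.
Qed.

Definition order_by (g : T -> nat) (g_inj : injective g) : linorder T :=
  LinOrder (order_by_subproof g_inj).

Lemma weak_order_by g (g_inj : injective g) x y :
  weak (order_by g_inj) x y = (g x <= g y)%N.
Proof. by rewrite /weak inE. Qed.

Lemma strict_order_by g (g_inj : injective g) x y :
  strict (order_by g_inj) x y = (g x < g y)%N.
Proof. by rewrite strictNweak weak_order_by ltnNge. Qed.

Lemma in_upper x y r : (y \in upper x r) = (rank r y < rank r x)%N.
Proof. by rewrite inE strict_rank. Qed.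

Definition swap u v r : linorder T :=
  order_by (inj_comp (@rank_inj r) (@perm_inj _ (tperm u v))).

Lemma strict_swap u v r x y : strict (swap u v r) x y =
  (rank r (tperm u v x) < rank r (tperm u v y))%N.
Proof. exact: strict_order_by. Qed.

Lemma adjacent_rank r u v : adjacent r u v ->
  (rank r u < rank r v)%N /\
  forall z, z != u -> z != v ->
    ((rank r z < rank r u) || (rank r v < rank r z))%N.
Proof.
case; rewrite strict_rank => uv adj; split=> // z zu zv.
have zu' : rank r z != rank r u by rewrite (inj_eq (@rank_inj r)).
have zv' : rank r z != rank r v by rewrite (inj_eq (@rank_inj r)).
by have := adj z; rewrite !strict_rank; lia.
Qed.

Lemma strict_swap_adjacent r u v x y : adjacent r u v ->
  [set x; y] != [set u; v] -> strict (swap u v r) x y = strict r x y.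
Proof.
move=> /adjacent_rank[uv adj]; rewrite strict_swap strict_rank => ne.
have uDv : u != v by apply: contraTneq uv => ->; rewrite ltnn.
have sep z : z != u -> z != v ->
  ((rank r z < rank r u) = (rank r z < rank r v))%N /\
  ((rank r u < rank r z) = (rank r v < rank r z))%N.
  by move=> zu zv; have := adj z zu zv; lia.
case: tpermP => [xu|xv|/eqP xu /eqP xv]; case: tpermP => [yu|yv|/eqP yu /eqP yv] //.
- by rewrite xu yu !ltnn.
- by rewrite xu yv eqxx in ne.
- by rewrite xu; case: (sep y) => // _ ->.
- by rewrite xv yu setUC eqxx in ne.
- by rewrite xv yv !ltnn.
- by rewrite xv; case: (sep y) => // _ ->.
- by rewrite yu; case: (sep x) => // ->.
- by rewrite yv; case: (sep x) => // ->.
Qed.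

Lemma strict_swap_pair r u v : strict (swap u v r) v u = strict r u v.
Proof. by rewrite strict_swap tpermL tpermR strict_rank. Qed.

Lemma neighbour_swap r u v : adjacent r u v -> neighbour r (swap u v r).
Proof.
move=> adj; exists u, v; split=> //; first by rewrite strict_swap_pair; case: adj.
move=> x y ne; apply/negb_inj; rewrite -!strictNweak strict_swap_adjacent //.
by rewrite setUC.
Qed.

Lemma upper_swap_adjacent r u v x : adjacent r u v -> x \notin [set u; v] ->
  upper x (swap u v r) = upper x r.
Proof.
move=> adj xuv; apply/setP=> y; rewrite !inE; apply: strict_swap_adjacent => //.
by apply: contraNneq xuv => <-; rewrite !inE eqxx orbT.
Qed.

(** Take an inverted pair whose ranks in [r] are closest: an object strictly between them would form
    a closer inverted pair with one of the two. *)
Lemma adjacent_inversion r r' : r != r' ->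
  exists u v, adjacent r u v /\ strict r' v u.
Proof.
move=> ne.
pose P (p : T * T) := strict r p.1 p.2 && strict r' p.2 p.1.
have /existsP[p0 Pp0] : [exists p, P p].
  apply: contraNT ne => /existsPn no; apply/eqP/linorder_ext => x y.
  have [->|xy] := eqVneq x y; first by rewrite !weak_refl.
  have := no (x, y); have := no (y, x); rewrite /P /= !strict_rank !weak_rank.
  have: rank r x != rank r y by rewrite (inj_eq (@rank_inj r)).
  have: rank r' x != rank r' y by rewrite (inj_eq (@rank_inj r')).
  lia.
case: (arg_minnP (fun p : T * T => rank r p.2 - rank r p.1)%N Pp0) => -[u v].
rewrite /P /= => /andP[uv vu] min_uv; exists u, v; split=> //; split=> // z [uz zv].
have [zu|uz'] := boolP (strict r' z u).
  have := min_uv (u, z); rewrite /= uz zu => /(_ isT).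
  by move: uv uz zv; rewrite !strict_rank; lia.
have vz : strict r' v z by move: vu uz'; rewrite !strict_rank; lia.
have := min_uv (z, v); rewrite /= zv vz => /(_ isT).
by move: uv uz zv; rewrite !strict_rank; lia.
Qed.

(** The inversion changes the upper contour set of both [u] and [v], so an object whose set is
    unchanged is neither. *)
Lemma swap_same_upper r r' u v x : adjacent r u v -> strict r' v u ->
  upper x r = upper x r' -> x \notin [set u; v].
Proof.
move=> [uv _] vu /setP e; rewrite !inE negb_or; apply/andP; split.
  apply/eqP=> xu; have := e v; rewrite !inE xu vu.
  by move: uv; rewrite !strict_rank; lia.
apply/eqP=> xv; have := e u; rewrite !inE xv uv.
by move: vu; rewrite !strict_rank; lia.
Qed.

(* Undoing an adjacent inversion between r and r' decreases their number. *)
Lemma swap_induction r' (P : linorder T -> Prop) :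
  P r' ->
  (forall r u v, adjacent r u v -> strict r' v u -> P (swap u v r) -> P r) ->
  forall r, P r.
Proof.
move=> P0 PS r.
pose inv r := #|[set p : T * T | strict r p.1 p.2 && strict r' p.2 p.1]|.
have [n] := ubnP (inv r); elim: n r => // n IH r.
have [->//|/adjacent_inversion[u [v [adj vu]]]] := eqVneq r r'.
rewrite ltnS => le_n; apply: (PS _ u v) => //; apply: IH.
apply: leq_trans le_n; apply: proper_card; apply/properP; split.
  apply/subsetP=> -[x y]; rewrite !inE /= => /andP[xy yx]; rewrite yx andbT.
  have [e|ne] := eqVneq [set x; y] [set u; v]; last by rewrite -(strict_swap_adjacent adj).
  move: xy yx; have: x \in [set u; v] by rewrite -e !inE eqxx.
  have: y \in [set u; v] by rewrite -e !inE eqxx orbT.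
  rewrite !inE => /orP[]/eqP-> /orP[]/eqP->.
  - by rewrite !strict_rank ltnn.
  - by move=> _; move: vu; rewrite !strict_rank; lia.
  - by case: adj.
  - by rewrite !strict_rank ltnn.
exists (u, v); rewrite !inE /= ?vu ?andbT; first by case: adj.
rewrite strict_swap tpermL tpermR; case: adj; rewrite strict_rank; lia.
Qed.

End LinearOrders.

(** * A vanishing principle for functions of a set of agents and a choice of objects *)

Definition upd (N O : finType) (lam : {ffun N -> O}) (t : N) (c : O) :
    {ffun N -> O} :=
  [ffun i => if i == t then c else lam i].

(* Differences of phi in one coordinate of lam satisfy the same hypotheses with
   one agent less, so phi is constant in lam by induction. A nonzero phi T then
   forces L h \subset L t for h outside and t inside T; any two such T differ by
   exchanging agents with equal L, so their phi agree, and these sum to 0. *)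
Lemma exchange_vanish (K : realFieldType) (N O : finType) (L : N -> {set O})
    (m : nat) (H : {set N}) (phi : {set N} -> {ffun N -> O} -> K)
    (valid := fun (H' : {set N}) (lam : {ffun N -> O}) =>
                forall h, h \in H' -> lam h \in L h) :
  (forall (T : {set N}) lam lam', T \subset H -> valid H lam -> valid H lam' ->
     {in H :\: T, lam =1 lam'} -> phi T lam = phi T lam') ->
  (forall lam, valid H lam ->
     \sum_(T : {set N} | (T \subset H) && (#|T| == m)) phi T lam = 0) ->
  (forall (T : {set N}) lam h t, T \subset H -> valid H lam -> phi T lam != 0 ->
     h \in H :\: T -> t \in T -> lam h \in L t) ->
  (forall (T : {set N}) lam h t, T \subset H -> valid H lam ->
     h \in H :\: T -> t \in T -> L h = L t -> lam h = lam t ->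
     phi T lam = phi (h |: T :\ t) lam) ->
  forall (T : {set N}) lam, T \subset H -> #|T| = m -> valid H lam ->
    phi T lam = 0.
Proof.
have [n] := ubnP #|H|; elim: n H phi => // n IH H phi; rewrite ltnS => le_n.
move=> indep sum0 supp ete.
have upd_valid lam t c : valid H lam -> c \in L t -> valid H (upd lam t c).
  by move=> V ct h hH; rewrite ffunE; case: eqP => [->|_] //; apply: V.
(* A coordinate of [lam] outside [T] can be changed freely: the difference [psi] is an instance of
   the same problem on [H :\ t]. *)
have single (T : {set N}) lam t c : T \subset H -> #|T| = m -> valid H lam ->
    t \in H :\: T -> c \in L t -> phi T (upd lam t c) = phi T lam.
  rewrite inE => TH cT V /andP[tT tH] ct.
  have ct' : lam t \in L t by apply: V.
  set H' := H :\ t.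
  have ltH : (#|H'| < n)%N by move: (cardsD1 t H); rewrite tH /H'; lia.
  have subH : forall T' : {set N}, T' \subset H' -> T' \subset H.
    by move=> T' /subset_trans; apply; apply: subsetDl.
  have validS mu d : d \in L t -> valid H' mu -> valid H (upd mu t d).
    move=> dL V' h hH; rewrite ffunE; case: eqP => [->|/eqP ht] //.
    by apply: V'; rewrite !inE ht.
  have notin (T' : {set N}) : T' \subset H' -> t \notin T'.
    by move=> s; apply/negP => /(subsetP s); rewrite !inE eqxx.
  pose psi (T' : {set N}) mu := phi T' (upd mu t c) - phi T' (upd mu t (lam t)).
  have -> : phi T lam = phi T (upd lam t (lam t)).
    by congr phi; apply/ffunP=> i; rewrite ffunE; case: eqP => [->|].
  apply/eqP; rewrite -subr_eq0; apply/eqP.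
  apply: (IH H' psi) => //.
  - move=> T' mu mu' /subH T'H Vm Vm' e; rewrite /psi.
    by congr (_ - _); apply: indep => //; try (by apply: validS);
      move=> i; rewrite !ffunE inE => /andP[iT iH]; case: eqP => // /eqP it;
      apply: e; rewrite !inE iT it.
  - move=> mu Vm; rewrite sumrB.
    (* The sets avoiding [t] carry minus the total of those containing [t], and the latter do not
       see the value at [t]; hence the same total for every [d]. *)
    have split d : d \in L t ->
      \sum_(T' : {set N} | (T' \subset H') && (#|T'| == m)) phi T' (upd mu t d)
      = - \sum_(T' : {set N} | [&& T' \subset H, #|T'| == m & t \in T'])
           phi T' (upd mu t (lam t)).
      move=> dL; have := sum0 _ (validS _ _ dL Vm).
      rewrite (bigID (fun T' : {set N} => t \in T')) /= => /eqP.
      rewrite addrC addr_eq0 => /eqP e; apply: etrans (etrans e _).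
        by apply: eq_bigl => T'; rewrite subsetD1; case: (t \in T'); rewrite /= ?andbF ?andbT.
      congr (- _); apply: eq_big => [T'|T' /andP[/andP[TH' _] tT']]; first by rewrite andbA.
      apply: indep => //; try (by apply: validS).
      move=> i; rewrite !ffunE inE => /andP[iT iH]; case: eqP => // it.
      by rewrite it tT' in iT.
    by rewrite (split c) // (split (lam t)) // subrr.
  - move=> T' mu h u T'H' Vm nz.
    rewrite !inE => /andP[hT /andP[ht hH]] uT.
    have [z1|nz1] := eqVneq (phi T' (upd mu t c)) 0.
      have nz2 : phi T' (upd mu t (lam t)) != 0.
        by apply: contraNneq nz => e; rewrite /psi e z1 subrr.
      have := supp T' _ h u (subH _ T'H') (validS _ _ ct' Vm) nz2.
      by rewrite ffunE (negbTE ht); apply; rewrite // inE hT.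
    have := supp T' _ h u (subH _ T'H') (validS _ _ ct Vm) nz1.
    by rewrite ffunE (negbTE ht); apply; rewrite // inE hT.
  - move=> T' mu h u T'H' Vm; rewrite !inE => /andP[hT /andP[ht hH]] uT eL e.
    have ut : u != t by apply: contraTneq uT => ->; apply: notin.
    by rewrite /psi; congr (_ - _); apply: ete; rewrite ?inE ?hT ?hH //;
      try (by apply: subH); try (by apply: validS); rewrite !ffunE (negbTE ht) (negbTE ut).
  - by rewrite subsetD1 TH tT.
  - by move=> h; rewrite !inE => /andP[_]; apply: V.
move=> T lam TH cT V; apply/eqP; apply: contraT => nz.
(* By [single], [lam h] may be replaced by any [c] in [L h] without making [phi] vanish, so the
   support condition puts every such [c] in [L t]. *)
have up (T' : {set N}) h t : T' \subset H -> #|T'| = m -> phi T' lam != 0 ->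
    h \in H :\: T' -> t \in T' -> L h \subset L t.
  move=> T'H cT' nz' hT' tT'; apply/subsetP=> c cL.
  have : phi T' (upd lam h c) != 0 by rewrite single.
  have Vc := upd_valid lam h c V cL.
  by move=> /(supp T' _ h t T'H Vc)/(_ hT' tT'); rewrite ffunE eqxx.
have same (T' T'' : {set N}) : T' \subset H -> #|T'| = m -> phi T' lam != 0 ->
    T'' \subset H -> #|T''| = m -> phi T'' lam != 0 -> phi T' lam = phi T'' lam.
  have [k] := ubnP #|T'' :\: T'|; elim: k T' => // k IHk T'; rewrite ltnS => le_k.
  move=> T'H cT' nz' T''H cT'' nz''.
  have [e|] := eqVneq (T'' :\: T') set0.
    congr phi; apply/esym/eqP; rewrite eqEcard cT' cT'' leqnn andbT.
    by rewrite -setD_eq0 e.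
  case/set0Pn=> h; rewrite inE => /andP[hT' hT''].
  have [t] : exists t, t \in T' :\: T''.
    apply/set0Pn; rewrite setD_eq0; apply: contra hT' => s.
    by rewrite (_ : T' = T'') //; apply/eqP; rewrite eqEcard s cT' cT'' leqnn.
  rewrite inE => /andP[tT'' tT'].
  have hH : h \in H by apply: (subsetP T''H).
  have tH : t \in H by apply: (subsetP T'H).
  have ht : h != t by apply: contraNneq hT' => ->.
  have eL : L h = L t.
    apply/eqP; rewrite eqEsubset.
    rewrite (up T') ?inE ?hT' //=.
    by rewrite (up T'') ?inE ?tT'' //.
  pose T1 := h |: T' :\ t.
  have T1H : T1 \subset H.
    apply/subsetP=> x; rewrite !inE => /orP[/eqP->//|/andP[_]]; exact: (subsetP T'H).
  have cT1 : #|T1| = m.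
    by rewrite cardsU1 !inE (negbTE hT') andbF /= -cT' (cardsD1 t T') tT'.
  have lt : lam h \in L t by rewrite -eL; apply: V.
  have Vu := upd_valid lam t (lam h) V lt.
  (* Setting the value at [t] to [lam h] is invisible while [t] is in [T']. It makes the exchange
     possible, after which [t] is outside [T1] and [single] restores [lam t]. *)
  have e1 : phi T' lam = phi T1 lam.
    rewrite (indep T' lam (upd lam t (lam h))) //; last first.
      move=> i; rewrite !ffunE inE => /andP[iT iH]; case: eqP => // it.
      by rewrite it tT' in iT.
    rewrite (ete T' _ h t) ?inE ?hT' //; last by rewrite !ffunE eqxx (negbTE ht).
    by apply: single; rewrite // !inE eqxx /= orbF eq_sym (negbTE ht) tH.
  rewrite e1; apply: IHk => //; last by rewrite -e1.
  apply: leq_trans le_k; apply: proper_card; apply/properP; split.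
    apply/subsetP=> x; rewrite !inE => /andP[+ xT]; rewrite xT andbT.
    rewrite negb_or negb_and negbK => /andP[_] /orP[/eqP e|//].
    by rewrite e (negbTE tT'') in xT.
  by exists h; rewrite !inE ?hT' ?eqxx.
have := sum0 lam V; rewrite (bigID (fun T' : {set N} => phi T' lam != 0)) /=.
rewrite [X in _ + X]big1 ?addr0; last by move=> T' /andP[_] /negPn/eqP.
rewrite (eq_bigr (fun=> phi T lam)); last first.
  by move=> T' /andP[/andP[T'H /eqP cT'] nz']; apply: same.
rewrite sumr_const => /eqP; rewrite mulrn_eq0 (negbTE nz) orbF => /eqP/card0_eq.
by move/(_ T); rewrite unfold_in /= TH cT eqxx nz.
Qed.

(** * Preferences respecting a weak order *)

Section Levels.
Variables (O : finType) (lev : O -> nat).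
Implicit Types r : linorder O.

(** The map [lev] encodes a weak order: lower levels are preferred, objects of equal level form a
    class, and [r] is free within each class. *)
Definition respects r : Prop :=
  forall x y, (lev x < lev y)%N -> (rank r x < rank r y)%N.

Definition below a r : {set O} :=
  [set x | (lev x == lev a) && (rank r a < rank r x)%N].

(* l is moved right after a: it gets the free odd slot following a. *)
Fact after_subproof a l r : injective (fun x =>
  if x == l then (rank r a).*2.+1 else (rank r x).*2).
Proof.
move=> x y /=; case: (eqVneq x l) (eqVneq y l) => [->|xl] [->|yl] //; try lia.
by move/double_inj/rank_inj.
Qed.

Definition after a l r : linorder O := order_by (@after_subproof a l r).

Lemma strict_after a l r x y : strict (after a l r) x y =
  ((if x == l then (rank r a).*2.+1 else (rank r x).*2) <
   (if y == l then (rank r a).*2.+1 else (rank r y).*2))%N.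
Proof. exact: strict_order_by. Qed.

Lemma rank_neq r x y : x != y -> rank r x != rank r y.
Proof. by rewrite (inj_eq (@rank_inj _ r)). Qed.

Lemma below_neq a r l : l \in below a r -> l != a.
Proof. by rewrite inE => /andP[_]; apply: contraTneq => ->; rewrite ltnn. Qed.

Variables (a l : O) (r : linorder O).
Hypotheses (r_resp : respects r) (l_below : l \in below a r).

Lemma after_respects : respects (after a l r).
Proof.
move: l_below; rewrite inE => /andP[/eqP ll al] x y xy.
rewrite -strict_rank strict_after; case: eqVneq => [e|xl]; case: eqVneq => [e'|yl].
- by rewrite e e' ltnn in xy.
- by have := r_resp xy; rewrite e; lia.
- by have : (rank r x < rank r a)%N by [apply: r_resp; rewrite -ll -e']; lia.
- by have := r_resp xy; lia.
Qed.

Lemma upper_after : upper a (after a l r) = upper a r.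
Proof.
have la := below_neq l_below; move: l_below; rewrite inE => /andP[_ al].
apply/setP=> x; rewrite !inE strict_after strict_rank (eq_sym a) (negbTE la).
by case: eqVneq => [->|_]; lia.
Qed.

Lemma upper_after_l : upper l (after a l r) = a |: upper a r.
Proof.
have la := below_neq l_below; move: l_below; rewrite inE => /andP[_ al].
apply/setP=> x; rewrite !inE strict_after strict_rank eqxx.
case: (eqVneq x l) => [->|xl]; first by rewrite (negbTE la); lia.
by case: (eqVneq x a) => [->|/(rank_neq r)]; lia.
Qed.

Lemma below_after : below a (after a l r) = below a r.
Proof.
have la := below_neq l_below; move: (l_below); rewrite inE => /andP[_ al].
apply/setP=> x; rewrite !inE -!strict_rank strict_after strict_rank (eq_sym a) (negbTE la).
by case: (eqVneq x l) => [->|_]; congr (_ && _); lia.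
Qed.

Lemma adjacent_after : adjacent (after a l r) a l.
Proof.
have la := below_neq l_below; move: l_below; rewrite inE => /andP[_ al].
split; first by rewrite strict_after eqxx (eq_sym a) (negbTE la); lia.
move=> z; rewrite !strict_after eqxx (eq_sym a) (negbTE la).
by case: (eqVneq z l) => _; lia.
Qed.

Lemma swap_after_respects : respects (swap a l (after a l r)).
Proof.
move=> x y xy; rewrite -strict_rank strict_swap_adjacent; first last.
- apply/eqP => /setP e.
  move: l_below; rewrite inE => /andP[/eqP ll _].
  have lx : lev x = lev a.
    by have := e x; rewrite !inE eqxx => /esym/orP[]/eqP->.
  have ly : lev y = lev a.
    by have := e y; rewrite !inE eqxx orbT => /esym/orP[]/eqP->.
  by rewrite lx ly ltnn in xy.
- exact: adjacent_after.
by rewrite strict_rank; apply: after_respects.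
Qed.

(** Moving [a] past [l] takes [l] out of the set below [a]; this makes [weight] decrease. *)
Lemma below_swap_after : below a (swap a l (after a l r)) \proper below a r.
Proof.
apply/properP; split.
  apply/subsetP=> x; rewrite inE => /andP[lx]; rewrite -strict_rank => ax.
  have [e|xl] := eqVneq x l; first by rewrite e.
  rewrite -below_after inE lx -strict_rank -(strict_swap_adjacent adjacent_after) //.
  apply/eqP => /setP/(_ l); rewrite !inE eqxx orbT (negbTE (below_neq l_below)) /=.
  by rewrite eq_sym (negbTE xl).
exists l => //; rewrite inE negb_and -strict_rank.
have := strict_swap_pair (after a l r) a l.
have [-> _] := adjacent_after; rewrite !strict_rank; lia.
Qed.

(** This lets a given profile be seen as one of its own shifts. Every object other than [l] is
    either weakly above [a] or strictly below [l]. *)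
Lemma after_first : (forall x, x \in below a r -> x != l -> (rank r l < rank r x)%N) ->
  after a l r = r.
Proof.
move=> first; apply: linorder_ext => x y.
have la := below_neq l_below; move: (l_below); rewrite inE => /andP[/eqP ll al].
have sep z : z != l -> (rank r z <= rank r a)%N || (rank r l < rank r z)%N.
  move=> zl; case: (leqP (rank r z) (rank r a)) => //= az.
  case: (ltngtP (lev z) (lev a)) => [/r_resp||e]; first by lia.
    by rewrite -ll => /r_resp.
  by apply: first; rewrite // inE e eqxx.
rewrite weak_order_by weak_rank.
case: eqVneq => [->|xl]; case: eqVneq => [->|yl]; rewrite ?leqnn //; last by rewrite leq_double.
  by have := sep y yl; lia.
by have := sep x xl; lia.
Qed.

End Levels.

(** Outside the class of [a] the levels decide; inside, the objects above [a] are those other than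
    [a] that are not below it. *)
Lemma upper_below (O : finType) (lev : O -> nat) a (r r' : linorder O) :
  respects lev r -> respects lev r' -> below lev a r = below lev a r' ->
  upper a r = upper a r'.
Proof.
move=> rr rr' /setP e; apply/setP=> x; rewrite !in_upper.
case: (ltngtP (lev x) (lev a)) => [lx|lx|lx].
- by rewrite rr ?rr'.
- by have := rr _ _ lx; have := rr' _ _ lx; lia.
have [->|xa] := eqVneq x a; first by rewrite !ltnn.
by have := e x; rewrite !inE lx eqxx /=; have := rank_neq r xa; have := rank_neq r' xa; lia.
Qed.

(** Doubling the levels frees an odd slot between the class of [a] and the next one, where [a]
    becomes a class of its own. *)
Definition demote (O : finType) (lev : O -> nat) (a : O) (x : O) : nat :=
  ((lev x).*2 + (x == a))%N.

Lemma demote_refines (O : finType) (lev : O -> nat) a x y :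
  (lev x < lev y)%N -> (demote lev a x < demote lev a y)%N.
Proof. by rewrite /demote; case: (x == a); case: (y == a); lia. Qed.

Lemma respects_demote (O : finType) (lev : O -> nat) a r :
  respects (demote lev a) r <-> respects lev r /\ below lev a r = set0.
Proof.
split=> [rr|[rr /setP b0] x y].
  split=> [x y /(@demote_refines _ _ a)/rr //|].
  apply/setP=> x; rewrite !inE; apply/negP => /andP[/eqP lx ax].
  have xa : x != a by apply: contraTneq ax => ->; rewrite ltnn.
  have : (rank r x < rank r a)%N.
    by apply: rr; rewrite /demote lx eqxx (negbTE xa); lia.
  by move: ax; lia.
case: (ltngtP (lev x) (lev y)) => [/rr //||e]; rewrite /demote.
  by case: (x == a); case: (y == a); lia.
rewrite e; case: (eqVneq x a) => [_|xa]; case: (eqVneq y a) => [ya|_]; try lia.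
have := b0 x; rewrite !inE e ya eqxx /=; have := rank_neq r xa; lia.
Qed.

(** * Assignments, trades and efficiency *)

Section Assignments.
Variables (N O : finType) (q : O -> nat).
Implicit Types (mu : assignment N q) (R : profile N O).

Lemma assignment_capacity mu x : (#|[set i | mu i == x]| <= q x)%N.
Proof. by case: mu => mu /= /forallP. Qed.

Lemma assignment_ext mu mu' : mu =1 mu' -> mu = mu'.
Proof. by move=> e; apply/val_inj/ffunP. Qed.

Fact permute_subproof (s : {perm N}) mu :
  [forall x, #|[set i | [ffun i => mu (s i)] i == x]| <= q x]%N.
Proof.
apply/forallP=> x; rewrite (_ : [set i | _] = s @^-1: [set i | mu i == x]).
  by rewrite card_preimset ?assignment_capacity //; apply: perm_inj.
by apply/setP=> i; rewrite !inE ffunE.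
Qed.

Definition permute (s : {perm N}) mu : assignment N q :=
  Assignment (permute_subproof s mu).

Lemma permuteE s mu i : permute s mu i = mu (s i).
Proof. exact: ffunE. Qed.

Lemma permute_tpermK i j : involutive (permute (tperm i j)).
Proof. by move=> mu; apply: assignment_ext => k; rewrite !permuteE tpermK. Qed.

Lemma efficient_no_trade R mu i j : efficient R mu ->
  strict (R i) (mu j) (mu i) -> strict (R j) (mu i) (mu j) -> False.
Proof.
move=> eff ij ji; apply: eff; exists (permute (tperm i j) mu); split.
  move=> k; rewrite permuteE; case: tpermP => [->|->|_ _]; last exact: weak_refl.
    by case/andP: ij.
  by case/andP: ji.
by exists i; rewrite permuteE tpermL.
Qed.

Lemma efficient_full R mu i x : efficient R mu -> strict (R i) x (mu i) ->
  (q x <= #|[set j | mu j == x]|)%N.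
Proof.
move=> eff xi; rewrite leqNgt; apply/negP => lt; apply: eff.
have cap : [forall y, #|[set j | upd (assign mu) i x j == y]| <= q y]%N.
  apply/forallP=> y; have [->|yx] := eqVneq y x.
    apply: leq_trans lt; apply: leq_trans (_ : #|i |: [set j | mu j == x]| <= _)%N.
      apply/subset_leq_card/subsetP=> j; rewrite !inE ffunE.
      by case: (j == i).
    by rewrite cardsU1; case: (_ \notin _); rewrite ?ltnS ?leqnn //= addn0.
  apply: leq_trans (assignment_capacity mu y); apply/subset_leq_card/subsetP=> j.
  by rewrite !inE ffunE; case: (j == i); rewrite // (eq_sym x) (negbTE yx).
exists (Assignment cap); split=> [k|]; last by exists i; rewrite /= ffunE eqxx.
rewrite /= ffunE; case: eqP => [->|_]; last exact: weak_refl.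
by case/andP: xi.
Qed.

End Assignments.

(** * Uniqueness *)

Section Uniqueness.
Variables (K : realFieldType) (N O : finType) (q : O -> nat) (lev0 : O -> nat).
Variable d : profile N O -> assignment N q -> K.
Implicit Types (R : profile N O) (mu : assignment N q) (S : {set N}).

Definition respecting R : Prop := forall i, respects lev0 (R i).

Hypothesis d_upper : forall R R' mu, respecting R -> respecting R' ->
  (forall i, upper (mu i) (R i) = upper (mu i) (R' i)) -> d R mu = d R' mu.
Hypothesis d_equal : forall R mu i j, respecting R -> R i = R j ->
  d R (permute (tperm i j) mu) = d R mu.
Hypothesis d_efficient : forall R mu, respecting R -> d R mu != 0 -> efficient R mu.

(** For fixed [mu], these [mu'] are the completions of the restriction of [mu] to the complement of
    [S]. *)
Definition agree S mu mu' := [forall i, (i \notin S) ==> (mu' i == mu i)].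

Lemma agreeP S mu mu' :
  reflect (forall i, i \notin S -> mu' i = mu i) (agree S mu mu').
Proof.
apply: (iffP forallP) => h i; first by move=> iS; apply/eqP/(implyP (h i)).
by apply/implyP => iS; apply/eqP/h.
Qed.

(** The hypothesis on sums is required at all these profiles, and not at [R] alone, so that the
    induction may vary the preferences inside [S]. *)
Definition extends S (lev : O -> nat) R R' : Prop :=
  [/\ respecting R', (forall i, i \in S -> respects lev (R' i))
    & forall i, i \notin S -> R' i = R i].

(** Equal treatment needs identical preferences, so [t] first adopts the preference of [h]. Neither
    this nor, once the objects are exchanged, the return to [R] changes an upper contour set that
    [d] depends on. *)
Lemma d_exchange R mu h t : respecting R ->
  upper (mu t) (R h) = upper (mu t) (R t) ->
  upper (mu h) (R h) = upper (mu h) (R t) ->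
  d R (permute (tperm h t) mu) = d R mu.
Proof.
move=> resp ut uh; pose R' := replace R t (R h).
have resp' : respecting R' by move=> i; rewrite ffunE; case: eqP.
rewrite (@d_upper R R' mu) //; last first.
  by move=> i; rewrite ffunE; case: eqP => // ->.
rewrite -(@d_equal R' mu h t resp'); last by rewrite !ffunE eqxx; case: eqP.
apply: d_upper => // i; rewrite permuteE ffunE.
by case: eqP => // ->; rewrite tpermR.
Qed.

(* If x were held less often under mu than under mu', it would not be full under
   mu although some agent of S holds a worse object. *)
Lemma common_counts S R mu0 mu mu' x : {in S &, forall i j, R i = R j} ->
  efficient R mu -> agree S mu0 mu -> agree S mu0 mu' ->
  (forall y i, i \in S -> (rank (R i) y < rank (R i) x)%N ->
    #|[set i in S | mu i == y]| = #|[set i in S | mu' i == y]|) ->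
  (#|[set i in S | mu' i == x]| <= #|[set i in S | mu i == x]|)%N.
Proof.
move=> common eff /agreeP ag /agreeP ag' eq_before; rewrite leqNgt; apply/negP => lt.
have [i0 i0S] : exists i, i \in S.
  have [i] : exists i, i \in [set i in S | mu' i == x].
    by apply/set0Pn; rewrite -card_gt0; lia.
  by rewrite inE => /andP[iS _]; exists i.
set r := R i0.
case: (pickP [pred i in S | (rank r x < rank r (mu i))%N]) => [i|none].
  rewrite inE => /andP[iS xi].
  have : strict (R i) x (mu i) by rewrite (common i i0) // strict_rank.
  move/(efficient_full eff); rewrite leqNgt => /negP; apply.
  have split (nu : assignment N q) : (forall i, i \notin S -> nu i = mu0 i) ->
     #|[set j | nu j == x]| =
     (#|[set j in S | nu j == x]| + #|[set j in ~: S | mu0 j == x]|)%N.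
    move=> agn; rewrite -(cardsID S [set j | nu j == x]); congr (_ + _)%N.
      by apply: eq_card => j; rewrite !inE andbC.
    apply: eq_card => j; rewrite !inE; case: (boolP (j \in S)) => //= jS.
    by rewrite agn.
  apply: leq_trans (assignment_capacity mu' x).
  by rewrite !split // ltn_add2r.
(* Here nobody in [S] holds an object worse than [x] under [mu]. The counts of the objects up to [x]
   then add up to [#|S|] under [mu] and to at most that under [mu']; as the counts before [x] agree,
   [x] cannot be held less often under [mu]. *)
pose A (nu : assignment N q) (y : O) := [set i in S | nu i == y].
have part (nu : assignment N q) (P : pred O) :
    #|[set i in S | P (nu i)]| = (\sum_(y | P y) #|A nu y|)%N.
  rewrite -sum1_card (partition_big (fun i => nu i) P) /=.
    apply: eq_bigr => y Py; rewrite -sum1_card; apply: eq_bigl => i.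
    by rewrite !inE -andbA; congr (_ && _); case: eqP => [->|]; rewrite ?Py ?andbF.
  by move=> i; rewrite inE => /andP[].
have : (#|S| <= #|[set i in S | (rank r (mu i) <= rank r x)%N]|)%N.
  apply/subset_leq_card/subsetP=> i iS; have := none i; rewrite !inE iS /=.
  by move/negbT; rewrite -leqNgt.
rewrite (part mu (fun y => rank r y <= rank r x)%N) (bigD1 x) //=.
have := subset_leq_card (subsetIl S [set i | (rank r (mu' i) <= rank r x)%N]).
rewrite (_ : S :&: _ = [set i in S | (rank r (mu' i) <= rank r x)%N]); last first.
  by apply/setP=> i; rewrite !inE.
rewrite (part mu' (fun y => rank r y <= rank r x)%N) (bigD1 x) //=.
rewrite (eq_bigr (fun y => #|A mu y|)) => [|y /andP[yx ynx]]; last first.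
  rewrite /A (eq_before y i0) //; have := rank_neq r ynx; rewrite -/r; lia.
rewrite /A; lia.
Qed.

(** Transpositions inside [S] lead from [mu] to [mu']. Equal counts provide, for a misplaced [i],
    another misplaced agent holding [mu' i]; exchanging the two settles [i]. *)
Lemma common_equal S R mu mu' : respecting R -> {in S &, forall i j, R i = R j} ->
  agree S mu mu' ->
  (forall x, #|[set i in S | mu i == x]| = #|[set i in S | mu' i == x]|) ->
  d R mu = d R mu'.
Proof.
move=> resp common; have [n] := ubnP #|[set i | mu i != mu' i]|.
elim: n mu => // n IH mu; rewrite ltnS => le_n /agreeP ag cnt.
have [i ne|same] := pickP (fun i => mu i != mu' i); last first.
  by congr d; apply: assignment_ext => i; apply/eqP/negbNE; rewrite same.
have iS : i \in S by apply: contraNT ne => /ag ->.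
have [j] : exists j, j \in [set k in S | mu k == mu' i] :\: [set k in S | mu' k == mu' i].
  apply/set0Pn; rewrite setD_eq0; apply/negP => sub.
  have /setP/(_ i) : [set k in S | mu k == mu' i] = [set k in S | mu' k == mu' i].
    by apply/eqP; rewrite eqEcard sub cnt leqnn.
  by rewrite !inE iS eqxx (negbTE ne).
rewrite !inE => /andP[+ /andP[jS /eqP ej]]; rewrite jS /= => nej.
have ij : i != j by apply: contraNneq ne => ij; rewrite -ej ij.
rewrite -(@d_equal R mu i j) //; last exact: common.
apply: IH.
- apply: leq_trans le_n; apply: proper_card; apply/properP; split.
    apply/subsetP=> k; rewrite !inE permuteE; case: tpermP => [->|->|_ _] // _.
    by rewrite ej eq_sym.
  by exists i; rewrite !inE ?ne // permuteE tpermL ej eqxx.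
- apply/agreeP => k kS; rewrite permuteE ag // tpermD //; apply: contraNneq kS => <- //.
move=> x; rewrite -cnt -(card_preimset [set k in S | mu k == x] (@perm_inj _ (tperm i j))).
apply: eq_card => k; rewrite !inE permuteE; congr (_ && _).
by case: tpermP => [->|->|]; rewrite ?iS ?jS.
Qed.

(** Efficiency fixes the counts in [S] object by object, from the best one down, so all nonzero
    values of [d] are equal. Since they sum to 0, there are none. *)
Lemma vanish_common S R mu0 : respecting R -> {in S &, forall i j, R i = R j} ->
  \sum_(mu | agree S mu0 mu) d R mu = 0 ->
  forall mu, agree S mu0 mu -> d R mu = 0.
Proof.
move=> resp common sum0 mu ag; apply/eqP; apply: contraT => nz.
have same mu' : agree S mu0 mu' -> d R mu' != 0 -> d R mu' = d R mu.
  move=> ag' nz'; apply: (@common_equal S) => //.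
    by apply/agreeP => i iS; rewrite (agreeP _ _ _ ag) // (agreeP _ _ _ ag').
  have [->|[i0 i0S]] := set_0Vmem S.
    by move=> x; congr #|pred_of_set _|; apply/setP=> i; rewrite !inE.
  move=> x; have [n] := ubnP (rank (R i0) x); elim: n x => // n IH x.
  rewrite ltnS => le_n; apply/eqP; rewrite eqn_leq.
  rewrite (@common_counts S R mu0 mu mu') ?(@common_counts S R mu0 mu' mu) //;
    try exact: d_efficient; move=> y i iS yx; rewrite IH //;
    by rewrite (common i0 i) //; apply: leq_trans yx _; rewrite (common i i0).
move: sum0; rewrite (bigID (fun mu' => d R mu' != 0)) /=.
rewrite [X in _ + X]big1 ?addr0; last by move=> mu' /andP[_] /negPn/eqP.
rewrite (eq_bigr (fun=> d R mu)) => [|mu' /andP[]]; last exact: same.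
rewrite sumr_const => /eqP; rewrite mulrn_eq0 (negbTE nz) orbF => /eqP/card0_eq.
by move/(_ mu); rewrite unfold_in /= ag nz.
Qed.


(** * Splitting an object off its class *)

Section Block.
Variables (S : {set N}) (lev : O -> nat) (R : profile N O) (mu0 : assignment N q).
Variable a : O.
Hypothesis lev_refines : forall x y, (lev0 x < lev0 y)%N -> (lev x < lev y)%N.
Hypothesis sum0 : forall R', extends S lev R R' ->
  \sum_(mu | agree S mu0 mu) d R' mu = 0.

Notation L := (fun R' : profile N O => fun i : N => below lev a (R' i)).

Definition movers R' := [set i in S | L R' i != set0].
(** Induction measure of [vanish_block]: the number of one-step moves that would bring [a] to the
    bottom of its class for all of [S]. *)
Definition weight R' := (\sum_(i in S) #|L R' i|)%N.
Definition shift (lam : {ffun N -> O}) R' : profile N O :=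
  [ffun i => if i \in movers R' then after a (lam i) (R' i) else R' i].
Definition picks (H T : {set N}) (lam : {ffun N -> O}) mu :=
  [forall h in H, mu h == if h \in T then a else lam h].
(* The number of agents of H who get a: a is either full or held by all of H. *)
Definition quota (H : {set N}) : nat :=
  minn #|H| (q a - #|[set i in ~: S | mu0 i == a]|).

Lemma lev_respects r : respects lev r -> respects lev0 r.
Proof. by move=> rr x y /lev_refines /rr. Qed.

(** * Profiles for which all lighter profiles are already settled *)

Section Minimal.
Variable R1 : profile N O.
Hypothesis R1_ext : extends S lev R R1.
Hypothesis lighter : forall R2 mu, extends S lev R R2 ->
  (weight R2 < weight R1)%N -> agree S mu0 mu -> d R2 mu = 0.
Let H := movers R1.
Let valid (lam : {ffun N -> O}) := forall h, h \in H -> lam h \in L R1 h.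

Lemma mover_in h : h \in H -> h \in S.
Proof. by rewrite inE => /andP[]. Qed.

Lemma R1_respects h : h \in S -> respects lev (R1 h).
Proof. by case: R1_ext => _ + _; apply. Qed.

Lemma shift_respects lam i : valid lam -> i \in S -> respects lev (shift lam R1 i).
Proof.
move=> V iS; rewrite ffunE; case: ifP => iH; last exact: R1_respects.
by apply: after_respects; [exact: R1_respects|exact: V].
Qed.

Lemma shift_extends lam : valid lam -> extends S lev R (shift lam R1).
Proof.
move=> V; case: R1_ext => resp respS off; split.
- move=> i; have [iS|iS] := boolP (i \in S); first exact/lev_respects/shift_respects.
  by rewrite ffunE inE (negbTE iS); apply: resp.
- by move=> i; apply: shift_respects.
by move=> i iS; rewrite ffunE inE (negbTE iS) off.
Qed.

Lemma shift_below lam i : valid lam -> i \in S -> L (shift lam R1) i = L R1 i.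
Proof.
move=> V iS /=; rewrite ffunE; case: ifP => // iH.
by apply: below_after; apply: V.
Qed.

(** If [mu h] were a third object, swapping the adjacent [a] and [lam h] for [h] would leave its
    upper contour set, hence [d], unchanged. The swapped profile is lighter, so [d] vanishes
    there. *)
Lemma shift_support lam mu h : valid lam -> agree S mu0 mu ->
  d (shift lam R1) mu != 0 -> h \in H -> (mu h == a) || (mu h == lam h).
Proof.
move=> V ag nz hH; have hS := mover_in hH; apply: contraNT nz => out.
have [resp' resp_S off] := shift_extends V.
pose R2 := replace (shift lam R1) h (swap a (lam h) (shift lam R1 h)).
have R2E i : R2 i = if i == h then swap a (lam h) (shift lam R1 h) else shift lam R1 i.
  by rewrite ffunE.
have eh : shift lam R1 h = after a (lam h) (R1 h) by rewrite ffunE hH.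
have r2h : respects lev (swap a (lam h) (shift lam R1 h)).
  by rewrite eh; apply: swap_after_respects; [exact: R1_respects|exact: V].
have R2_ext : extends S lev R R2.
  split=> [i|i iS|i iS]; rewrite R2E; have [e|_] := eqVneq i h; rewrite ?e //.
  - exact: lev_respects.
  - exact: resp_S.
  - by rewrite e hS in iS.
  - exact: off.
apply/eqP; rewrite -(lighter R2_ext _ ag).
  apply: d_upper => //; first by case: R2_ext.
  move=> i; rewrite R2E; have [->|//] := eqVneq i h; rewrite eh; apply/esym.
  by apply: upper_swap_adjacent; [apply: adjacent_after; exact: V|rewrite !inE].
rewrite /weight (bigD1 h) //= [X in (_ < X)%N](bigD1 h) //= -addSn leq_add //.
  rewrite R2E eqxx eh; apply: proper_card; apply: below_swap_after.
  exact: V.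
apply: leq_sum => i /andP[iS ih]; rewrite R2E (negbTE ih).
by have /= -> := shift_below V iS.
Qed.

(** Agent [h] prefers [a] to [lam h]; if [t] preferred [lam h] to [a], the two would trade. *)
Lemma shift_no_trade lam mu h t : valid lam -> agree S mu0 mu ->
  d (shift lam R1) mu != 0 -> h \in H -> mu h = lam h -> t \in S -> mu t = a ->
  lam h \in L R1 t.
Proof.
move=> V ag nz hH eh tS et; apply: contraT => nin.
have [resp' _ _] := shift_extends V.
have hin := V h hH; have hS := mover_in hH.
case: (@efficient_no_trade N O q (shift lam R1) mu h t (d_efficient resp' nz)).
  rewrite et eh ffunE hH; by case: (adjacent_after hin).
rewrite et eh strict_rank; move: nin; rewrite -(shift_below V tS) /= inE.
move: hin; rewrite inE => /andP[/eqP-> al]; rewrite eqxx /= => nlt.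
have := rank_neq (shift lam R1 t) (below_neq (V h hH)); lia.
Qed.

(** Either all of [H] gets [a], or some [h] holds the worse [lam h] and [a] is full by efficiency.
    In the latter case [shift_no_trade] excludes holders of [a] in [S] outside [H], where nothing of
    the class is below [a]. *)
Lemma shift_quota lam mu : valid lam -> agree S mu0 mu ->
  d (shift lam R1) mu != 0 -> #|[set h in H | mu h == a]| = quota H.
Proof.
move=> V ag nz; have [resp' _ _] := shift_extends V.
have eff := d_efficient resp' nz.
set T := [set h in H | mu h == a]; set c := #|[set i in ~: S | mu0 i == a]|.
have TH : (#|T| <= #|H|)%N by apply/subset_leq_card/subsetP=> h; rewrite inE => /andP[].
have off : #|[set i in ~: S | mu i == a]| = c.
  apply: eq_card => i; rewrite !inE; case: (boolP (i \in S)) => //= iS.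
  by rewrite (agreeP _ _ _ ag).
have cap : (#|T| + c <= q a)%N.
  apply: leq_trans (assignment_capacity mu a); rewrite -off -cardsUI.
  rewrite (_ : T :&: _ = set0) ?cards0 ?addn0; last first.
    apply/setP=> i; rewrite !inE; case: (boolP (i \in S)) => //=; rewrite ?andbF //.
  apply/subset_leq_card/subsetP=> i; rewrite !inE.
  by case/orP => /andP[].
have [TH'|[h]] := set_0Vmem (H :\: T).
  have : #|T| = #|H|.
    by apply/eqP; rewrite eqn_leq TH subset_leq_card // -setD_eq0 TH'.
  by rewrite /quota -/c; lia.
rewrite in_setD => /andP[+ hH]; rewrite inE hH /= => ha.
have := shift_support V ag nz hH; rewrite (negbTE ha) /= => /eqP eh.
have : strict (shift lam R1 h) a (mu h).
  by rewrite eh ffunE hH; case: (adjacent_after (V h hH)).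
move/(efficient_full eff).
suff : (#|[set i | mu i == a]| <= #|T| + c)%N by rewrite /quota -/c; lia.
rewrite -off -cardsUI; apply: leq_trans (leq_addr _ _).
apply/subset_leq_card/subsetP=> i; rewrite !inE => ia; rewrite ia !andbT.
case: (boolP (i \in S)) => [iS|_] /=; last by rewrite ?orbT.
by rewrite orbF; apply/set0Pn; exists (lam h); apply: (shift_no_trade V ag nz hH eh iS); apply/eqP.
Qed.

Lemma shift_upper lam i : valid lam -> i \in H -> upper a (shift lam R1 i) = upper a (R1 i).
Proof. by move=> V iH; rewrite ffunE iH; apply: upper_after; apply: V. Qed.

Lemma picks_value (T : {set N}) (lam : {ffun N -> O}) mu h : picks H T lam mu -> h \in H ->
  mu h = if h \in T then a else lam h.
Proof. by move=> /forall_inP p /p /eqP. Qed.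

Lemma picks_unique (T : {set N}) (lam : {ffun N -> O}) mu : valid lam -> T \subset H ->
  picks H T lam mu -> T = [set h in H | mu h == a].
Proof.
move=> V TH p; apply/setP=> h; rewrite inE.
case: (boolP (h \in H)) => [hH|hH] /=; last first.
  by apply: contraNF hH; apply: (subsetP TH).
rewrite (picks_value p hH); case: ifP => _; first by rewrite eqxx.
by apply/esym/negbTE; apply: below_neq (V h hH).
Qed.

Lemma picks_tperm (T : {set N}) (lam : {ffun N -> O}) mu h t : h \in H -> t \in H -> h \notin T ->
  t \in T -> lam h = lam t ->
  picks H (h |: T :\ t) lam (permute (tperm h t) mu) = picks H T lam mu.
Proof.
move=> hH tH hT tT e.
have inT k : (tperm h t k \in h |: T :\ t) = (k \in T).
  rewrite !inE; case: tpermP => [->|->|/eqP kh /eqP kt].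
  - by rewrite eqxx (negbTE hT) eq_sym; case: eqP hT => // ->; rewrite tT.
  - by rewrite eqxx.
  - by rewrite (negbTE kh) kt.
have inH k : (tperm h t k \in H) = (k \in H).
  by case: tpermP => [->|->|]; rewrite ?hH ?tH.
have lamE k : lam (tperm h t k) = lam k by case: tpermP => [->|->|].
apply/forall_inP/forall_inP => p k kH.
  by have := p (tperm h t k); rewrite inH permuteE tpermK inT lamE; apply.
by have := p (tperm h t k); rewrite inH -inT tpermK lamE permuteE; apply.
Qed.

(** This is [exchange_vanish] for the total [phi T lam] of [d] over the completions in which [T]
    gets [a] and every other [h] in [H] gets [lam h]. *)
Lemma sum_shift_eq0 (T : {set N}) (lam : {ffun N -> O}) : T \subset H -> #|T| = quota H -> valid lam ->
  \sum_(mu | agree S mu0 mu && picks H T lam mu) d (shift lam R1) mu = 0.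
Proof.
pose phi (T : {set N}) (lam : {ffun N -> O}) :=
  \sum_(mu | agree S mu0 mu && picks H T lam mu) d (shift lam R1) mu.
move: T lam; apply: (@exchange_vanish K N O (L R1) (quota H) H phi) => /=.
(* Agents of [T] hold [a], and the upper contour set of [a] does not depend on which object is
   placed just below it. *)
- move=> T lam lam' TH V V' e; apply: eq_big => [mu|mu /andP[_ p]].
    congr (_ && _); apply: eq_forallb => h; case: (boolP (h \in H)) => //= hH; case: ifP => // hT.
    by rewrite e // inE hT.
  apply: d_upper; try by case: (shift_extends V).
    by case: (shift_extends V').
  move=> i; have [iH|iH] := boolP (i \in H); last by rewrite !ffunE (negbTE iH).
  have := picks_value p iH; case: ifP => [_ ->|iT _]; first by rewrite !shift_upper.
  by rewrite !ffunE iH e // inE iT.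
(* Each assignment charged by [d] is counted for exactly one [T], its set of holders of [a] in [H],
   which has the required size. *)
- move=> lam V; rewrite -[RHS](sum0 (shift_extends V)).
  rewrite /phi; under eq_bigr do rewrite big_mkcondr /=.
  rewrite exchange_big /=; apply: eq_bigr => mu ag.
  have [z|nz] := eqVneq (d (shift lam R1) mu) 0.
    by rewrite big1 // => T _; rewrite z if_same.
  have p : picks H [set h in H | mu h == a] lam mu.
    apply/forall_inP => h hH; rewrite inE hH /=.
    by have := shift_support V ag nz hH; case: ifP.
  rewrite (bigD1 [set h in H | mu h == a]) /=; last first.
    rewrite (shift_quota V ag nz) eqxx andbT; apply/subsetP=> h.
    by rewrite inE => /andP[].
  rewrite p big1 ?addr0 // => T /andP[/andP[TH _] ne].
  by case: ifP => // p'; rewrite -(picks_unique V TH p') eqxx in ne.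
- move=> T lam h t TH V nz; rewrite inE => /andP[hT hH] tT.
  have tH := subsetP TH _ tT.
  have [mu /= /andP[/andP[ag p] nz']|none] :=
    pickP [pred mu | agree S mu0 mu && picks H T lam mu & d (shift lam R1) mu != 0].
    apply: (shift_no_trade V ag nz' hH) => //; last 1 first.
    + by rewrite (picks_value p tH) tT.
    + by rewrite (picks_value p hH) (negbTE hT).
    + exact: mover_in.
  move/eqP: nz; case; apply: big1 => mu P; have := none mu.
  by rewrite /= P /= => /negbFE/eqP.
(* Reindexing by the transposition of [h] and [t] reduces the symmetry to [d_exchange]; equal sets
   below [a] give equal upper contour sets of [a] and of the common object [lam h]. *)
move=> T lam h t TH V; rewrite inE => /andP[hT hH] tT eL e.
have tH := subsetP TH _ tT.
rewrite /phi [RHS](reindex_inj (inv_inj (@permute_tpermK N O q h t))) /=.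
apply: eq_big => [mu|mu /andP[_ p]].
  rewrite picks_tperm //; congr (_ && _).
  have out k : k \notin S -> tperm h t k = k.
    by move=> kS; rewrite tpermD //; apply: contraNneq kS => <-; apply: mover_in.
  by apply: eq_forallb => k; case: (boolP (k \in S)) => //= kS; rewrite permuteE out.
apply/esym/d_exchange; first by case: (shift_extends V).
  rewrite (picks_value p tH) tT !shift_upper //.
  by apply: upper_below eL; apply: R1_respects; apply: mover_in.
rewrite (picks_value p hH) (negbTE hT) !ffunE hH tH.
rewrite (upper_after_l (V h hH)) e (upper_after_l (V t tH)).
congr (_ |: _); apply: upper_below eL; apply: R1_respects; exact: mover_in.
Qed.

End Minimal.

Hypothesis IH : forall (S' : {set N}) R' mu0', S' \subset S -> respecting R' ->
  (forall i, i \in S' -> respects (demote lev a) (R' i)) ->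
  (forall R'', extends S' (demote lev a) R' R'' ->
     \sum_(mu | agree S' mu0' mu) d R'' mu = 0) ->
  forall mu, agree S' mu0' mu -> d R' mu = 0.

(** Induction on [weight]. Once [mu] is fixed on [H], the agents of [S :\: H] all have [a] at the
    bottom of its class, and [IH] applies to them with [a] demoted. *)
Lemma vanish_block R1 mu : extends S lev R R1 -> agree S mu0 mu -> d R1 mu = 0.
Proof.
have [n] := ubnP (weight R1); elim: n R1 mu => // n IHn R1 mu.
rewrite ltnS => le_n ext ag.
have lighter R2 mu' : extends S lev R R2 -> (weight R2 < weight R1)%N ->
    agree S mu0 mu' -> d R2 mu' = 0.
  by move=> e2 lt; apply: IHn e2; apply: leq_trans lt le_n.
have [resp respS off] := ext.
set H := movers R1; apply/eqP; apply: contraT => nz.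
(* The object of the class nearest below [a]; agents outside [H] receive the dummy value [a]. *)
have ex h : {l | h \in H -> l \in below lev a (R1 h) /\
    forall x, x \in below lev a (R1 h) -> x != l -> (rank (R1 h) l < rank (R1 h) x)%N}.
  case: (boolP (h \in H)) => [hH|_]; last by exists a.
  case: (pickP [pred l | l \in below lev a (R1 h)]) => [l0 l0L|none]; last first.
    exists a; move: hH; rewrite inE => /andP[_ /set0Pn[x xL]].
    by have := none x; rewrite /= xL.
  exists [arg min_(l < l0 in below lev a (R1 h)) rank (R1 h) l].
  case: arg_minnP => // l lL l_min _; split=> // x xL xl.
  by rewrite ltn_neqAle l_min // andbT eq_sym rank_neq.
pose lam : {ffun N -> O} := [ffun h => sval (ex h)].
have V h : h \in H -> lam h \in below lev a (R1 h).
  by move=> hH; rewrite ffunE; case: (svalP (ex h) hH).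
(* With this [lam] the shift does nothing, and this is needed at all profiles [R2] over which [IH]
   requires a vanishing sum. *)
have shiftE R2 : movers R2 = H -> {in H, R2 =1 R1} -> shift lam R2 = R2.
  move=> mE e; apply/ffunP => i; rewrite ffunE mE; case: ifP => // iH.
  rewrite e //; have [iL i_first] := svalP (ex i) iH.
  by apply: (@after_first _ lev); rewrite ?ffunE //; apply/respS/mover_in/iH.
have sE1 := shiftE R1 erefl (fun _ _ => erefl).
rewrite -sE1 in nz.
have sup h := shift_support ext lighter V ag nz (h := h).
set T := [set h in H | mu h == a].
have TH : T \subset H by apply/subsetP=> h; rewrite inE => /andP[].
have cT : #|T| = quota H := shift_quota ext lighter V ag nz.
have HS : H \subset S by apply/subsetP=> h; apply: mover_in.
case/negP: nz; rewrite sE1; apply/eqP.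
apply: (IH (S' := S :\: H) (mu0' := mu)) => //.
- exact: subsetDl.
- move=> i; rewrite !inE => /andP[+ iS]; rewrite iS /= negbK => /eqP b0.
  by apply/respects_demote; split=> //; apply: respS.
(* Varying the agents of [S :\: H] with [a] kept at the bottom of its class changes neither the
   movers nor the weight, so [sum_shift_eq0] applies to [R2] too. *)
- move=> R2 [resp2 resp2S off2].
  have R2H : {in H, R2 =1 R1} by move=> i iH; apply: off2; rewrite inE iH.
  have R2G i : i \in S -> i \notin H ->
      respects lev (R2 i) /\ below lev a (R2 i) = set0.
    by move=> iS iH; apply/respects_demote/resp2S; rewrite inE iH.
  have b2 i : i \in S -> below lev a (R2 i) = below lev a (R1 i).
    move=> iS; case: (boolP (i \in H)) => [/R2H->//|iH].
    by case: (R2G i iS iH) => _ ->; move: iH; rewrite inE iS /= negbK => /eqP.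
  have mE : movers R2 = H.
    by apply/setP=> i; rewrite !inE; case: (boolP (i \in S)) => //= /b2->.
  have w2 : weight R2 = weight R1 by apply: eq_bigr => i /b2->.
  have ext2 : extends S lev R R2.
    split=> [|i iS|i iS]; first exact: resp2.
      by case: (boolP (i \in H)) => [/R2H->|/(R2G i iS)[]//]; apply: respS.
    by rewrite -off // off2 // inE (negbTE iS) andbF.
  have V2 h : h \in movers R2 -> lam h \in below lev a (R2 h).
    by rewrite mE => hH; rewrite R2H //; apply: V.
  rewrite -w2 in lighter.
  have := @sum_shift_eq0 R2 ext2 lighter T lam; rewrite mE shiftE // => z.
  rewrite -[RHS]z //; last by move=> h hH; apply: V2; rewrite mE.
  (* Agreeing with [mu] off [S :\: H] means agreeing with [mu0] off [S] and making on [H] the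
     choices recorded by [T] and [lam]. *)
  apply: eq_bigl => mu'; apply/agreeP/andP => [ag'|[/agreeP ag' p] i].
    split.
      apply/agreeP => i iS; rewrite ag' ?inE ?(negbTE iS) ?andbF //.
      exact: (agreeP _ _ _ ag).
    apply/forall_inP => h hH; rewrite ag' ?in_setD ?hH // [h \in T]inE hH /=.
    by have := sup h hH; case: ifP.
  rewrite inE negb_and negbK => /orP[iH|iS].
    rewrite (picks_value p iH) inE iH /=.
    by have := sup i iH; case: eqP => [->//|_ /= /eqP].
  by rewrite ag' // (agreeP _ _ _ ag).
exact/agreeP.
Qed.

End Block.

(** Induction on the number of tied pairs. Without ties all agents of [S] have the same preference;
    otherwise a tied object [a] is split off, which removes the tie with [b]. *)
Lemma vanish S lev R mu0 :
  (forall x y, (lev0 x < lev0 y)%N -> (lev x < lev y)%N) ->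
  respecting R -> (forall i, i \in S -> respects lev (R i)) ->
  (forall R', extends S lev R R' -> \sum_(mu | agree S mu0 mu) d R' mu = 0) ->
  forall mu, agree S mu0 mu -> d R mu = 0.
Proof.
pose ties (lev : O -> nat) := [set p : O * O | (p.1 != p.2) && (lev p.1 == lev p.2)].
have [n] := ubnP #|ties lev|; elim: n S lev R mu0 => // n IH S lev R mu0.
rewrite ltnS => le_n refines resp respS sum0 mu ag.
have self : extends S lev R R by split.
have [t0|[[a b]]] := set_0Vmem (ties lev).
  apply: vanish_common (sum0 _ self) _ ag => // i j iS jS; apply: linorder_ext => x y.
  have [->|xy] := eqVneq x y; first by rewrite !weak_refl.
  have /setP/(_ (x, y)) := t0; rewrite !inE /= xy /= !weak_rank => /negbT.
  by rewrite neq_ltn => /orP[] lt; have := respS _ iS _ _ lt;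
    have := respS _ jS _ _ lt; lia.
rewrite inE /= => /andP[ab /eqP e].
apply: (@vanish_block S lev R mu0 a) => // S' R' mu0' S'S resp' resp'S sum0' mu'.
apply: IH sum0' mu' => //; last by move=> x y /refines; apply: demote_refines.
apply: leq_trans le_n; apply: proper_card; apply/properP; split.
  apply/subsetP=> -[x y]; rewrite !inE /= => /andP[xy /eqP]; rewrite xy /demote.
  by case: (x == a); case: (y == a) => /=; lia.
exists (a, b); rewrite !inE /= ab ?e //= /demote e eqxx (eq_sym b) (negbTE ab); lia.
Qed.

Lemma uniqueness R mu : respecting R ->
  (forall R', respecting R' -> \sum_mu d R' mu = 0) -> d R mu = 0.
Proof.
move=> resp sum0; apply: (@vanish setT lev0 R mu) => //.
  move=> R' [resp' _ _]; rewrite -[RHS](sum0 R') //; apply: eq_bigl => mu'.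
  by apply/agreeP => i; rewrite inE.
by apply/agreeP.
Qed.

End Uniqueness.

(** * Random Priority *)

Section Greedy.
Variables (N O : finType) (q : O -> nat).
Implicit Types (R : profile N O) (t : linorder N) (mu : assignment N q).

(** A description of the outcome of serial dictatorship without the fold, so that Random Priority
    counts the priority orders for which [mu] is greedy. *)
Definition greedy R t mu : bool :=
  [forall i, forall x, (#|[set j | strict t j i && (mu j == x)]| < q x)%N ==>
     weak (R i) (mu i) x].

Lemma greedyP R t mu : reflect
  (forall i x, (#|[set j | strict t j i && (mu j == x)]| < q x)%N ->
     weak (R i) (mu i) x) (greedy R t mu).
Proof.
apply: (iffP forallP) => [g i x|g i]; first by move/forallP: (g i) => /(_ x) /implyP.
by apply/forallP => x; apply/implyP; apply: g.
Qed.

Lemma greedy_monotonic R R' t mu : monotonic_transformation mu R R' ->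
  greedy R t mu -> greedy R' t mu.
Proof.
move=> mono /greedyP g; apply/greedyP => i x /g; apply: contraTT.
rewrite -!strictNweak => xi; have := subsetP (mono i) x; rewrite !inE; exact.
Qed.

(** Under [mu'] agent [i] and the earlier holders of [mu' i] fit within its capacity, so a copy is
    left when [i] chooses. *)
Lemma greedy_capacity t mu mu' i :
  (forall j, strict t j i -> mu' j = mu j) ->
  (#|[set j | strict t j i && (mu j == mu' i)]| < q (mu' i))%N.
Proof.
move=> same; apply: leq_trans (assignment_capacity mu' (mu' i)).
apply: proper_card; apply/properP; split; last first.
  by exists i; rewrite !inE ?eqxx // strict_rank ltnn.
by apply/subsetP=> j; rewrite !inE => /andP[/same->].
Qed.

Lemma priority_ind t (P : N -> Prop) :
  (forall i, (forall j, strict t j i -> P j) -> P i) -> forall i, P i.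
Proof.
move=> step i; have [n] := ubnP (rank t i); elim: n i => // n IH i le_n.
by apply: step => j; rewrite strict_rank => lt; apply: IH; lia.
Qed.

Lemma greedy_dominated R t mu mu' : greedy R t mu ->
  (forall i, weak (R i) (mu' i) (mu i)) -> mu' = mu.
Proof.
move=> /greedyP g better; apply: assignment_ext; apply: (priority_ind (t := t)).
move=> i IH; apply: (@weak_anti _ (R i)); rewrite better /=.
exact/g/greedy_capacity.
Qed.

Lemma greedy_efficient R t mu : greedy R t mu -> efficient R mu.
Proof.
move=> g [mu' [better [j]]]; rewrite (greedy_dominated g better).
by rewrite strict_rank ltnn.
Qed.

Lemma greedy_unique R t mu mu' : greedy R t mu -> greedy R t mu' -> mu = mu'.
Proof.
move=> /greedyP g /greedyP g'; apply: assignment_ext.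
apply: (priority_ind (t := t)) => i IH; apply: (@weak_anti _ (R i)).
rewrite g ?g' //; first exact: greedy_capacity.
by apply: greedy_capacity => j /IH.
Qed.

Lemma swap_involutive i j t : swap i j (swap i j t) = t.
Proof.
apply: linorder_ext => x y; apply: negb_inj; rewrite -!strictNweak.
by rewrite strict_swap -strict_rank strict_swap !tpermK -strict_rank.
Qed.

Lemma greedy_swap R t mu i j : R i = R j ->
  greedy R (swap i j t) (permute (tperm i j) mu) = greedy R t mu.
Proof.
have imp t' mu' : R i = R j -> greedy R t' mu' ->
    greedy R (swap i j t') (permute (tperm i j) mu').
  move=> e /greedyP g; apply/greedyP => k x.
  rewrite permuteE (_ : R k = R (tperm i j k)); last by case: tpermP => [->|->|].
  move=> lt; apply: g; apply: leq_trans lt; rewrite ltnS.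
  rewrite -(card_preimset _ (@perm_inj _ (tperm i j))); apply/subset_leq_card/subsetP.
  by move=> l; rewrite !inE permuteE strict_swap strict_rank.
move=> e; apply/idP/idP; last exact: imp.
by move/(imp _ _ e); rewrite swap_involutive permute_tpermK.
Qed.

Lemma strict_sort_index t i j :
  strict t j i = (index j (sort (weak t) (enum N)) < index i (sort (weak t) (enum N)))%N.
Proof.
set s := sort _ _.
have s_sorted : sorted (weak t) s by apply: sort_sorted; apply: weak_total.
have in_s k : k \in s by rewrite mem_sort mem_enum.
have mono k l : (index k s < index l s)%N -> strict t k l.
  move=> lt; have := sorted_ltn_index (@weak_trans _ t) s_sorted _ _ (in_s k) (in_s l) lt.
  rewrite weak_rank strict_rank leq_eqVlt => /orP[/eqP/rank_inj e|//].
  by rewrite e ltnn in lt.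
apply/idP/idP; last exact: mono.
apply: contraTT; rewrite -leqNgt leq_eqVlt => /orP[/eqP e|/mono].
  have -> : i = j by rewrite -(nth_index i (in_s i)) e nth_index.
  by rewrite strict_rank ltnn.
by rewrite !strict_rank; lia.
Qed.

Lemma choose_bestE R (nu : {ffun N -> option O}) i x0 : available q nu x0 ->
  exists x, [/\ available q nu x, forall y, available q nu y -> weak (R i) x y
    & forall j, choose_best q R nu i j = if j == i then Some x else nu j].
Proof.
move=> av0; rewrite /choose_best.
have [x /andP[av best]|none] := pickP (fun x => available q nu x &&
    [forall y, available q nu y ==> weak (R i) x y]).
  exists x; split=> // [y|j]; last by rewrite ffunE.
  by move/forallP: best => /(_ y) /implyP.
have := none [arg min_(x < x0 | available q nu x) rank (R i) x].
case: arg_minnP => // x -> x_min /negP[]; apply/forallP=> y; apply/implyP.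
by rewrite weak_rank; apply: x_min.
Qed.

Hypothesis q_enough : (#|N| <= \sum_(x : O) q x)%N.

(** Loop invariant, proved by appending agents at the end. Its last clause may count holders in the
    final [nu] because later agents do not alter earlier choices. *)
Lemma foldl_choose_best R (s : seq N) (nu := foldl (choose_best q R) [ffun=> None] s) :
  uniq s ->
  [/\ forall j, j \notin s -> nu j = None,
      forall x, (#|[set j | nu j == Some x]| <= q x)%N
    & forall i, i \in s -> exists x, nu i = Some x /\
        forall y, (#|[set j | (index j s < index i s)%N && (nu j == Some y)]| < q y)%N ->
        weak (R i) x y].
Proof.
rewrite {}/nu; elim/last_ind: s => [_|s i IH].
  split=> // [j _|x]; first by rewrite ffunE.
  by rewrite (_ : [set _ | _] = set0) ?cards0 //; apply/setP=> j; rewrite !inE ffunE.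
rewrite rcons_uniq foldl_rcons => /andP[i_s /IH[]].
set nu := foldl _ _ _ => none cap best.
(* Agent [i] is still unassigned, so fewer than [#|N|] copies are taken and not every object is
   full. *)
have [x0 av0] : exists x, available q nu x.
  apply/existsP; apply: contraT => /existsPn full.
  have lt : (#|[set j | nu j != None]| < #|N|)%N.
    rewrite -cardsT; apply: proper_card; apply/properP; split; first exact: subsetT.
    by exists i; rewrite // inE none ?eqxx.
  have : (\sum_x q x <= \sum_x #|[set j | nu j == Some x]|)%N.
    by apply: leq_sum => x _; have := full x; rewrite /available -leqNgt.
  suff : (\sum_x #|[set j | nu j == Some x]| <= #|[set j | nu j != None]|)%N.
    by move: q_enough; lia.
  (* The object [o] is only a default for [odflt]; without objects the sum is empty. *)
  case: (pickP (fun _ : O => true)) => [o _|e]; last by rewrite big_pred0.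
  rewrite -sum1_card (partition_big (fun j => odflt o (nu j)) predT) //=.
  apply: leq_sum => x _; rewrite -sum1_card; apply: eq_leq; apply: eq_bigl => j.
  rewrite !inE; case: (nu j) => [y|] //=.
have [x [av x_best nuE]] := choose_bestE R i av0.
have nuE' j : j \in s -> choose_best q R nu i j = nu j.
  by move=> js; rewrite nuE; case: eqP => // e; rewrite -e js in i_s.
split.
- move=> j; rewrite mem_rcons inE negb_or nuE => /andP[/negbTE-> /none //].
- move=> y; have [->|yx] := eqVneq y x.
    apply: leq_trans av; apply: leq_trans (_ : #|i |: [set j | nu j == Some x]| <= _)%N.
      by apply/subset_leq_card/subsetP=> j; rewrite !inE nuE; case: (j == i).
    by rewrite cardsU1; case: (_ \notin _); rewrite /= ?add1n ?add0n.
  apply: leq_trans (cap y); apply/subset_leq_card/subsetP=> j; rewrite !inE nuE.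
  by case: (j == i) => // /eqP[e]; rewrite e eqxx in yx.
move=> k; rewrite mem_rcons inE => /orP[/eqP->|ks].
  exists x; split; first by rewrite nuE eqxx.
  move=> y lt; apply: x_best; apply: leq_trans lt; rewrite ltnS.
  apply/subset_leq_card/subsetP=> j; rewrite !inE => jy.
  have js : j \in s by apply: contraLR jy => /none ->.
  by rewrite nuE' // jy andbT -cats1 !index_cat js (negbTE i_s) ltn_addr // index_mem.
have [z [kz z_best]] := best k ks; exists z; split; first by rewrite nuE'.
move=> y lt; apply: z_best; apply: leq_trans lt; rewrite ltnS.
apply/subset_leq_card/subsetP=> j; rewrite !inE => /andP[jk jy].
have js : j \in s by apply: contraLR jy => /none ->.
by rewrite nuE' // jy andbT -cats1 !index_cat js ks.
Qed.

Lemma serial_dictatorshipP R t :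
  exists mu, serial_dictatorship q R t = [ffun i => Some (mu i)] /\ greedy R t mu.
Proof.
have s_uniq : uniq (sort (weak t) (enum N)) by rewrite sort_uniq enum_uniq.
have [_ cap best] := foldl_choose_best R s_uniq.
rewrite /serial_dictatorship; set nu := foldl _ _ _ in cap best *.
have val i : {x | nu i = Some x}.
  case e: (nu i) => [x|]; first by exists x.
  by exfalso; have [|x []] := best i; rewrite ?mem_sort ?mem_enum // e.
have cap' : [forall x, #|[set i | [ffun i => sval (val i)] i == x]| <= q x]%N.
  apply/forallP => x; apply: leq_trans (cap x); apply/subset_leq_card/subsetP=> i.
  by rewrite !inE ffunE => /eqP <-; apply/eqP; apply: (svalP (val i)).
have nuE i : nu i = Some (Assignment cap' i) by rewrite /= ffunE; apply: (svalP (val i)).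
exists (Assignment cap'); split; first by apply/ffunP=> i; rewrite nuE [RHS]ffunE.
apply/greedyP => i x lt.
have [|y [ey]] := best i; first by rewrite mem_sort mem_enum.
move: (ey); rewrite nuE => -[->]; apply; apply: leq_trans lt; rewrite ltnS.
by apply/subset_leq_card/subsetP=> j; rewrite !inE nuE -strict_sort_index.
Qed.

Lemma serial_dictatorship_greedy R t mu :
  (serial_dictatorship q R t == [ffun i => Some (mu i)]) = greedy R t mu.
Proof.
have [mu' [-> g]] := serial_dictatorshipP R t.
apply/eqP/idP => [/ffunP e|g']; last by rewrite (greedy_unique g g').
suff <- : mu' = mu by [].
by apply: assignment_ext => i; have := e i; rewrite !ffunE => -[].
Qed.

End Greedy.

(** * Counting linear orders *)

Lemma card_lt_ord n m : (m <= n)%N -> #|[set k : 'I_n | (k < m)%N]| = m.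
Proof.
move=> le_mn; rewrite -[RHS]card_ord -[RHS]sum1_card (big_ord_widen n (fun=> 1%N)) //.
by rewrite -sum1_card; apply: eq_bigl => k; rewrite inE.
Qed.

(** The rank functions of linear orders are exactly the injections of [T] into ['I_#|T|]. For
    surjectivity, such an injection is bijective, so [g x] elements precede [x] in the order it
    induces. *)
Lemma card_linorder (T : finType) : #|{: linorder T}| = (#|T|`!)%N.
Proof.
pose f t : {ffun T -> 'I_#|T|} := [ffun x => Ordinal (rank_lt_card t x)].
have f_inj : injective f.
  move=> t t' /ffunP e; apply: linorder_ext => x y; rewrite !weak_rank.
  by have := e x; have := e y; rewrite !ffunE => /(congr1 val)/= -> /(congr1 val)/= ->.
rewrite -(card_imset _ f_inj) -ffactnn -[X in (X ^_ _)%N]card_ord -card_inj_ffuns.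
apply: eq_card => g; rewrite inE; apply/imsetP/injectiveP => [[t _ ->] x y|g_inj].
  by rewrite !ffunE => /(congr1 val)/rank_inj.
have vg_inj : injective (fun x => val (g x)) by move=> x y /val_inj/g_inj.
exists (order_by vg_inj) => //; apply/ffunP => x; apply: val_inj; rewrite ffunE /=.
have g_bij : bijective g by apply: inj_card_bij g_inj _; rewrite card_ord.
rewrite /rank (_ : upper _ _ = g @^-1: [set k : 'I_#|T| | (k < g x)%N]); last first.
  by apply/setP=> y; rewrite !inE strict_order_by.
rewrite on_card_preimset; last exact: onW_bij.
by rewrite card_lt_ord // ltnW.
Qed.

(** * Random Priority satisfies the axioms *)

Section RandomPriority.
Variables (K : realFieldType) (N O : finType) (q : O -> nat).
Hypothesis q_enough : (#|N| <= \sum_(x : O) q x)%N.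
Implicit Types (R : profile N O) (mu : assignment N q).

Lemma random_priorityE R mu : random_priority K R mu =
  (#|N|`!%:R)^-1 * \sum_(t : linorder N) (greedy R t mu)%:R.
Proof.
by congr (_ * _); apply: eq_bigr => t _; rewrite serial_dictatorship_greedy.
Qed.

Lemma random_priority_sum R : \sum_(mu : assignment N q) random_priority K R mu = 1.
Proof.
under eq_bigr do rewrite random_priorityE.
rewrite -mulr_sumr exchange_big /= (eq_bigr (fun=> 1)) => [|t _].
  rewrite sumr_const card_linorder mulVf // pnatr_eq0 -lt0n fact_gt0 //.
have [mu [_ g]] := serial_dictatorshipP q_enough R t.
rewrite (bigD1 mu) //= g big1 ?addr0 // => mu' ne.
by case: (boolP (greedy R t mu')) => // /(greedy_unique g) e; rewrite e eqxx in ne.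
Qed.

Lemma random_priority_monotonic R R' mu : monotonic_transformation mu R R' ->
  random_priority K R mu <= random_priority K R' mu.
Proof.
move=> mono; rewrite !random_priorityE ler_wpM2l ?invr_ge0 ?ler0n //.
apply: ler_sum => t _; rewrite ler_nat.
by have := greedy_monotonic (t := t) mono; case: greedy => // ->.
Qed.

Lemma random_priority_equal R mu i j : R i = R j ->
  random_priority K R (permute (tperm i j) mu) = random_priority K R mu.
Proof.
move=> e; rewrite !random_priorityE; congr (_ * _).
rewrite (reindex_inj (inv_inj (swap_involutive i j))).
by apply: eq_bigr => t _; rewrite greedy_swap.
Qed.

Lemma random_priority_efficient R mu :
  random_priority K R mu != 0 -> efficient R mu.
Proof.
rewrite random_priorityE.
have [t /greedy_efficient //|none] := pickP (fun t => greedy R t mu).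
by rewrite big1 ?mulr0 ?eqxx // => t _; rewrite none.
Qed.

End RandomPriority.

(** * The equivalences *)

(** Both domains become the profiles respecting a weak order: a single class, or the null object
    alone in a last class. *)
Definition domain_level (O : finType) (D : pref_domain O) (x : O) : nat :=
  if D is NullLast null then (x == null) else 0.

Lemma in_domainP (N O : finType) (D : pref_domain O) (R : profile N O) :
  in_domain D R <-> forall i, respects (domain_level D) (R i).
Proof.
case: D => [|null] /=; first by split=> // _ i x y; rewrite ltnn.
split=> [/forallP dom i x y|resp].
  rewrite /=; case: (eqVneq y null) => [->|_]; last by case: (x == null).
  case: eqVneq => // xn _; rewrite -strict_rank /strict.
  move/forallP: (dom i) => /(_ x) xw; rewrite xw /=; apply: contra xn => nw.
  by apply/eqP/(@weak_anti _ (R i)); rewrite xw.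
apply/forallP => i; apply/forallP => x; case: (eqVneq x null) => [->|xn].
  exact: weak_refl.
by rewrite weak_rank ltnW // resp //= eqxx (negbTE xn).
Qed.

(** Two respecting orders disagree on [u] and [v], so these are tied and may be swapped without
    leaving the domain. *)
Lemma swap_respects (O : finType) (lev : O -> nat) (r r' : linorder O) u v :
  respects lev r -> respects lev r' -> adjacent r u v -> strict r' v u ->
  respects lev (swap u v r).
Proof.
move=> rr rr' adj vu x y xy; rewrite -strict_rank.
have [e|ne] := eqVneq [set x; y] [set u; v]; last first.
  by rewrite strict_swap_adjacent // strict_rank; apply: rr.
have: x \in [set u; v] by rewrite -e !inE eqxx.
have: y \in [set u; v] by rewrite -e !inE eqxx orbT.
have := rr _ _ xy; have := rr' _ _ xy; move: vu; case: adj; rewrite !strict_rank => uv _ vu.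
by rewrite !inE => lt' lt /orP[]/eqP ey /orP[]/eqP ex; move: lt lt'; rewrite ex ey; lia.
Qed.

(** The pair swapped between neighbours must be the one whose comparison is seen to flip. *)
Lemma neighbour_strict (O : finType) (r r' : linorder O) x y a b :
  neighbour r r' -> strict r x y -> strict r' y x -> [set a; b] != [set x; y] ->
  strict r' a b = strict r a b.
Proof.
case=> [u [v [_ _ same]]] xy yx; have [<-|ne] := eqVneq [set u; v] [set x; y].
  by move=> ne; rewrite /strict !same // setUC.
have yx' : weak r' y x = weak r y x by apply: same; rewrite setUC eq_sym.
by move: xy yx; rewrite /strict yx' => /andP[_ /negbTE->].
Qed.

Lemma neighbour_upper (O : finType) (r r' : linorder O) x y z :
  neighbour r r' -> strict r x y -> strict r' y x -> z \notin [set x; y] ->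
  upper z r' = upper z r.
Proof.
move=> nb xy yx zxy; apply/setP=> w; rewrite !inE.
apply: (neighbour_strict nb xy yx).
by apply: contraNneq zxy => <-; rewrite !inE eqxx orbT.
Qed.

Section Rules.
Variables (K : realFieldType) (N O : finType) (q : O -> nat) (D : pref_domain O).
Variable f : rule K N q D.
Implicit Types (R : dprofile N D) (mu : assignment N q).

Lemma replace_same R i : replace R i (R i) = R.
Proof. by apply/ffunP=> j; rewrite ffunE; case: eqP => // ->. Qed.

Lemma replace_replace (R : profile N O) i r r' :
  replace (replace R i r) i r' = replace R i r'.
Proof. by apply/ffunP=> j; rewrite !ffunE; case: eqP. Qed.

Lemma replace_at (R : profile N O) i r : replace R i r i = r.
Proof. by rewrite ffunE eqxx. Qed.

Lemma dprofile_eq R R' : profile_of R = profile_of R' -> R = R'.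
Proof. exact: val_inj. Qed.

Lemma dprofile_respects R i : respects (domain_level D) (R i).
Proof. by case: R => R /= /in_domainP. Qed.

Lemma in_domain_replace R i r : respects (domain_level D) r -> in_domain D (replace R i r).
Proof.
by move=> rr; apply/in_domainP => j; rewrite ffunE; case: ifP => // _;
  apply: dprofile_respects.
Qed.

Lemma replace_respects (R : profile N O) i r :
  in_domain D (replace R i r) -> respects (domain_level D) r.
Proof. by move=> /in_domainP/(_ i); rewrite replace_at. Qed.

Lemma prob_ge0 (p : random_assignment K N q) mu : 0 <= p mu.
Proof. by case: p. Qed.

Lemma prob_sum1 (p : random_assignment K N q) : \sum_mu p mu = 1.
Proof. by case: p. Qed.

Lemma marginal_sum1 (p : random_assignment K N q) i : \sum_a marginal p i a = 1.
Proof.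
rewrite -(prob_sum1 p) [RHS](partition_big (fun mu : assignment N q => mu i) predT) //.
Qed.

Lemma sum_marginal_compl (p : random_assignment K N q) i (U : {set O}) :
  \sum_(y in U) marginal p i y = 1 - \sum_(y | y \notin U) marginal p i y.
Proof. by rewrite -(marginal_sum1 p i) [in RHS](bigID (mem U)) /= addrK. Qed.

(** * Monotonicity implies strategy-proofness and weak object-wise non-bossiness *)

Section Monotonic.
Hypothesis mono : prob_monotonic f.

Lemma monotonic_upper R R' mu :
  (forall i, upper (mu i) (R i) = upper (mu i) (R' i)) -> f R mu = f R' mu.
Proof. by move=> e; apply/le_anti; rewrite !mono // => i; rewrite e. Qed.

Lemma monotonic_strategy_proof : strategy_proof f.
Proof.
move=> R i r hD x; set U := upper x (R i).
(* The deviation is split at the order ranking U on top, ordered by r, and the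
   other objects below, ordered by R i. *)
pose g y := (if y \in U then rank r y else #|O| + rank (R i) y)%N.
have g_inj : injective g.
  move=> y z; rewrite /g; have := rank_lt_card r y; have := rank_lt_card r z.
  by case: ifP => _; case: ifP => _ => ? ?; [apply: rank_inj|lia|lia|
    move/addnI; apply: rank_inj].
have memU y : (y \in U) = (rank (R i) y < rank (R i) x)%N by rewrite in_upper.
have rr := replace_respects hD.
(* The intermediate order stays in the domain, since [U] is an upper set of [R i] and both orders
   respect the levels. *)
have gr : respects (domain_level D) (order_by g_inj).
  move=> y z yz; rewrite -strict_rank strict_order_by /g !memU.
  have := dprofile_respects R i yz; have := rr _ _ yz.
  have := rank_lt_card r y; have := rank_lt_card r z.
  by case: ifP; case: ifP; lia.
have hT := in_domain_replace R i gr.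
have top y : y \in U -> upper y (order_by g_inj) \subset upper y r.
  move=> yU; apply/subsetP=> z; rewrite !inE strict_order_by strict_rank /g yU.
  by case: ifP => // _; have := rank_lt_card r y; lia.
have bottom y : y \notin U -> upper y (order_by g_inj) = upper y (R i).
  move=> yU; apply/setP=> z; rewrite !inE strict_order_by strict_rank /g (negbTE yU).
  move: yU; rewrite !memU; have := rank_lt_card r z.
  by case: ifP; lia.
apply: le_trans (_ : \sum_(y in U) marginal (f (DProfile hT)) i y <= _).
  apply: ler_sum => y yU; apply: ler_sum => mu /eqP muy; apply: mono => j /=.
  by rewrite !ffunE; case: eqP => // ->; rewrite muy; apply: top.
(* Objects outside [U] have the same upper contour sets in both orders, hence the same marginals; so
   [U] has the same total mass. *)
rewrite !sum_marginal_compl lerD2l lerN2 le_eqVlt; apply/orP; left; apply/eqP.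
apply: eq_bigr => y yU; apply: eq_bigr => mu /eqP muy; apply: monotonic_upper => j /=.
by rewrite ffunE; case: eqP => // ->; rewrite muy bottom.
Qed.

(** The swap moves the probabilities of all assignments giving [z] to [i] in one direction: down if
    [z] is the demoted [x], up otherwise. Equality of their sums forces equality termwise. *)
Lemma monotonic_nonbossy : weakly_objectwise_nonbossy f.
Proof.
move=> i x y z R r hD nb xy yx e mu muz.
have termwise (F G : assignment N q -> K) :
    \sum_(mu : assignment N q | mu i == z) F mu =
    \sum_(mu : assignment N q | mu i == z) G mu ->
    (forall mu : assignment N q, mu i == z -> F mu <= G mu) -> F mu = G mu.
  move=> /eqP eFG le_FG; apply/esym/eqP; rewrite -subr_eq0; apply/eqP.
  apply: (@psumr_eq0P _ _ (fun mu : assignment N q => mu i == z)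
    (fun mu => G mu - F mu)); last by rewrite muz.
    by move=> nu nuz; rewrite subr_ge0 le_FG.
  by apply/eqP; rewrite sumrB subr_eq0 eq_sym.
have strictE := neighbour_strict nb xy yx.
have [zx|zx] := eqVneq z x.
  apply/esym/termwise => // nu /eqP nuz; apply: mono => j /=; rewrite ffunE.
  case: eqP => // ->; rewrite nuz zx; apply/subsetP=> w; rewrite !inE => wx.
  rewrite strictE //; apply/eqP => /setP/(_ y); rewrite !inE eqxx orbT.
  case/orP=> /eqP ey; move: wx xy; rewrite -?ey !strict_rank; lia.
apply: termwise => // nu /eqP nuz; apply: mono => j /=; rewrite ffunE.
case: eqP => // ->; rewrite nuz; apply/subsetP=> w; rewrite !inE => wz.
rewrite -strictE //; apply/eqP => e2; move: wz yx.
have /setP/(_ z) := e2; rewrite !inE eqxx orbT (negbTE zx) /= => /esym/eqP->.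
have /setP/(_ x) := e2; rewrite !inE eqxx eq_sym (eq_sym x z) (negbTE zx) orbF.
by move=> /eqP->; rewrite !strict_rank; lia.
Qed.

End Monotonic.

(** * Strategy-proofness and weak object-wise non-bossiness imply responsiveness *)

Section NonBossy.
Hypotheses (sp : strategy_proof f) (nonbossy : weakly_objectwise_nonbossy f).

(** A weak upper contour set is either all of [O] or the strict upper contour set of the best object
    outside it. *)
Lemma strategy_proof_upper_eq R i r (hD : in_domain D (replace R i r)) z :
  \sum_(y in z |: upper z (R i)) marginal (f (DProfile hD)) i y <=
  \sum_(y in z |: upper z (R i)) marginal (f R) i y.
Proof.
set U := z |: _.
have [w0 w0U|full] := pickP [pred w | w \notin U]; last first.
  rewrite !(eq_bigl predT) ?marginal_sum1 //; by move=> y; have := full y => /negbFE.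
pose w := [arg min_(w < w0 | w \notin U) rank (R i) w].
suff -> : U = upper w (R i) by apply: sp.
rewrite /w; case: arg_minnP => // v vU v_min; apply/setP=> y; rewrite in_upper.
apply/idP/idP => [|lt]; last by apply: contraLR lt => /v_min; rewrite -leqNgt.
move: vU; rewrite !inE !strict_rank negb_or => /andP[vz] nvz.
by have vz' := rank_neq (R i) vz; case/orP => [/eqP->|]; lia.
Qed.

(** Strategy-proofness, used in both directions, fixes the mass of the strict and weak upper contour
    sets of [z], which the swap preserves. Their difference is the marginal of [z], so non-bossiness
    applies. *)
Lemma strategy_proof_responsive : pairwise_responsive f.
Proof.
move=> i x y R r hD nb xy yx mu muxy.
apply: (nonbossy nb xy yx) (erefl _); set z := mu i in muxy *.
have eU := neighbour_upper nb xy yx muxy.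
have hD' : in_domain D (replace (DProfile hD) i (R i)).
  by rewrite replace_replace replace_same; case: R {hD nb xy yx eU}.
have back : DProfile hD' = R.
  by apply: dprofile_eq; rewrite /= replace_replace replace_same.
have e1 : \sum_(y in upper z (R i)) marginal (f (DProfile hD)) i y =
          \sum_(y in upper z (R i)) marginal (f R) i y.
  apply/le_anti; rewrite sp /=; have := sp hD' z.
  by rewrite back /= replace_at eU.
have e2 : \sum_(y in z |: upper z (R i)) marginal (f (DProfile hD)) i y =
          \sum_(y in z |: upper z (R i)) marginal (f R) i y.
  apply/le_anti; rewrite strategy_proof_upper_eq /=.
  have := strategy_proof_upper_eq hD' z.
  by rewrite back /= replace_at eU.
move: e2; rewrite !big_setU1 ?inE ?strict_rank ?ltnn //= e1.
by move/addIr/esym.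
Qed.

End NonBossy.

(** * Pairwise responsiveness implies Random Priority *)

Section Responsive.
Hypothesis responsive : pairwise_responsive f.

(** Adjacent inversions with respect to [r] are undone one by one; none of these swaps involves
    [mu i], and all intermediate orders lie in the domain. *)
Lemma responsive_replace R i r (hD : in_domain D (replace R i r)) mu :
  upper (mu i) (R i) = upper (mu i) r -> f R mu = f (DProfile hD) mu.
Proof.
have rr := replace_respects hD.
suff H r0 (hD0 : in_domain D (replace R i r0)) :
    upper (mu i) r0 = upper (mu i) r -> f (DProfile hD0) mu = f (DProfile hD) mu.
  have hD0 : in_domain D (replace R i (R i)).
    by apply: in_domain_replace; apply: dprofile_respects.
  move/(H (R i) hD0) <-; congr (f _ _); apply: dprofile_eq.
  by rewrite /= replace_same.
elim/(@swap_induction _ r): r0 hD0 => [hD0 _|r0 u v adj vu IH hD0 e].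
  by congr (f _ _); apply: dprofile_eq.
have r0r := replace_respects hD0.
have hD1 : in_domain D (replace R i (swap u v r0)).
  by apply: in_domain_replace; apply: swap_respects vu.
have hD2 : in_domain D (replace (DProfile hD0) i (swap u v r0)).
  by rewrite replace_replace.
have out := swap_same_upper adj vu e.
rewrite -(IH hD1); last by rewrite upper_swap_adjacent.
have -> : DProfile hD1 = DProfile hD2.
  by apply: dprofile_eq; rewrite /= replace_replace.
by apply: (@responsive i u v) => //=; rewrite ?replace_at;
  [apply: neighbour_swap|case: adj|rewrite strict_swap_pair; case: adj].
Qed.

Lemma responsive_upper R R' mu :
  (forall i, upper (mu i) (R i) = upper (mu i) (R' i)) -> f R mu = f R' mu.
Proof.
move=> e; pose mix (s : seq N) : profile N O :=
  [ffun i => if i \in s then R' i else R i].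
have mixE s i : mix s i = if i \in s then R' i else R i by rewrite ffunE.
have mixD s : in_domain D (mix s).
  by apply/in_domainP => i; rewrite mixE; case: ifP => _; apply: dprofile_respects.
have step s : f R mu = f (DProfile (mixD s)) mu.
  elim: s => [|i s ->].
    by congr (f _ _); apply: dprofile_eq; apply/ffunP=> i; rewrite /= mixE.
  have hD : in_domain D (replace (DProfile (mixD s)) i (R' i)).
    by apply: in_domain_replace; apply: dprofile_respects.
  rewrite (responsive_replace hD); last by rewrite /= mixE; case: ifP.
  congr (f _ _); apply: dprofile_eq; apply/ffunP=> j; rewrite /= ffunE !mixE inE.
  by case: eqP => // ->.
rewrite (step (enum N)); congr (f _ _); apply: dprofile_eq.
by apply/ffunP=> i; rewrite /= mixE mem_enum.
Qed.

Hypothesis q_enough : (#|N| <= \sum_(x : O) q x)%N.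
Hypotheses (f_eff : ex_post_efficient f) (f_ete : equal_treatment f).

Lemma responsive_random_priority R mu : f R mu = random_priority K R mu.
Proof.
pose d (R' : profile N O) (nu : assignment N q) : K :=
  (* The value 0 off the domain only makes [d] total; [uniqueness] looks at respecting profiles,
     which are those of the domain. *)
  if insub R' is Some R0 then f R0 nu - random_priority K R' nu else 0.
have dE (R' : dprofile N D) nu : d R' nu = f R' nu - random_priority K R' nu.
  by rewrite /d valK.
have lift (R' : profile N O) : respecting (domain_level D) R' ->
    exists R0 : dprofile N D, R' = R0.
  by move=> /in_domainP h; exists (DProfile h).
apply/eqP; rewrite -subr_eq0 -dE; apply/eqP.
apply: (@uniqueness K N O q (domain_level D) d).
- move=> R1 R2 nu /lift[R1' ->] /lift[R2' ->] e; rewrite !dE.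
  rewrite (responsive_upper e); congr (_ - _); apply/le_anti.
  by rewrite !random_priority_monotonic // => i; rewrite e.
- move=> R1 nu i j /lift[R1' ->] e; rewrite !dE random_priority_equal //.
  congr (_ - _); apply: (f_ete e); rewrite ?permuteE ?tpermL ?tpermR //.
  by move=> k ki kj; rewrite permuteE tpermD // eq_sym.
- move=> R1 nu /lift[R1' ->]; rewrite dE.
  (* If Random Priority gives [nu] probability 0, then [f] gives it a positive one; either way [nu]
     is efficient. *)
  have [->|nz _] := eqVneq (random_priority K R1' nu) 0.
    by rewrite subr0 => nz; apply: f_eff; rewrite lt_def nz prob_ge0.
  exact: random_priority_efficient nz.
- exact: dprofile_respects.
move=> R' /lift[R0 ->]; under eq_bigr do rewrite dE.
by rewrite sumrB prob_sum1 random_priority_sum // subrr.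
Qed.

End Responsive.
End Rules.

Theorem theorem1 (K : realFieldType) (N O : finType) (q : O -> nat)
    (q_gt0 : forall x, (0 < q x)%N)
    (q_enough : (#|N| <= \sum_(x : O) q x)%N)
    (D : pref_domain O) (q_null : null_capacity N q D)
    (f : rule K N q D)
    (f_eff : ex_post_efficient f) (f_ete : equal_treatment f) :
  [<-> prob_monotonic f;
       strategy_proof f /\ weakly_objectwise_nonbossy f;
       pairwise_responsive f;
       forall (R : dprofile N D) (mu : assignment N q),
         f R mu = random_priority K R mu].
Proof.
tfae.
- move=> mono; split; first exact: monotonic_strategy_proof.
  exact: monotonic_nonbossy.
- by case; apply: strategy_proof_responsive.
- by move=> responsive R mu; apply: responsive_random_priority.
by move=> fE R R' mu mono; rewrite !fE random_priority_monotonic.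
Qed.
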